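(* Assume that there is $\varepsilon>0$ with $\sum_{p\ge1}\beta_p^2(1+\varepsilon)^p\sum_{\mathsf s\in\mathscr S^p}\Delta^2_{\mathsf s}\lambda^{\mathsf s}<\infty$. Then for any $\boldsymbol\lambda$-admissible pairs $(\zeta_1,\Phi_1)$ and $(\zeta_2,\Phi_2)$, $$|\mathscr P(\zeta_1,\Phi_1)-\mathscr P(\zeta_2,\Phi_2)|\le\frac{C_*}2\,\mathcal D\big((\zeta_1,\Phi_1),(\zeta_2,\Phi_2)\big),\qquad\text{where}\quad C_*=\sup_{s,s'\in\mathscr S}\frac{\partial\xi^s}{\partial q^{s'}}(\boldsymbol 1)$$ and $\boldsymbol 1\in\mathbb R^{\mathscr S}$ is the vector of all ones.
   Context: Let $\mathscr S$ be a finite set and $\boldsymbol\lambda=(\lambda^s)_{s\in\mathscr S}$ with $\lambda^s\in(0,1]$, $\sum_s\lambda^s=1$. For each $p\ge1$ let $(\Delta^2_{s_1,\dots,s_p})_{s_1,\dots,s_p\in\mathscr S}$ be a symmetric array of nonnegative reals, and $\beta_p\in\mathbb R$. For $\mathsf s=(s_1,\dots,s_p)$ and $\boldsymbol q=(q^s)_{s\in\mathscr S}$ write $q^{\mathsf s}=q^{s_1}\cdots q^{s_p}$, similarly $\lambda^{\mathsf s}$. For $\boldsymbol q\in[-1,1]^{\mathscr S}$ set $$\xi(\boldsymbol q)=\sum_{p\ge1}\beta_p^2\sum_{\mathsf s\in\mathscr S^p}\Delta^2_{\mathsf s}\lambda^{\mathsf s}q^{\mathsf s},\qquad \xi^s(\boldsymbol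 q)=\frac1{\lambda^s}\frac{\partial\xi}{\partial q^s}(\boldsymbol q),\qquad\theta(\boldsymbol q)=\boldsymbol q\cdot\nabla\xi(\boldsymbol q)-\xi(\boldsymbol q).$$ A map $\Phi=(\Phi^s)_{s\in\mathscr S}:[0,1]\to[0,1]^{\mathscr S}$ is $\boldsymbol\lambda$-admissible if every $\Phi^s$ is continuous and non-decreasing and $\sum_s\lambda^s\Phi^s(q)=q$ for all $q\in[0,1]$. A $\boldsymbol\lambda$-admissible pair $(\zeta,\Phi)$ consists of a Borel probability measure $\zeta$ on $[0,1]$ and a $\boldsymbol\lambda$-admissible map $\Phi$ (which is automatically Lipschitz, so the derivatives below exist a.e.). Parisi functional: let $d^s(q)=\int_q^1\zeta([0,u])(\xi^s\circ\Phi)'(u)\,du$; for $\boldsymbol b\in(0,\infty)^{\mathscr S}$ with $b^s>d^s(0)$ for each $s$, let $$A(\zeta,\Phi,\boldsymbol b)=\sum_{s\in\mathscr S}\frac{\lambda^s}2\Big[b^s-1-\log b^s+\frac{\xi^s(\boldsymbol 0)}{b^s-d^s(0)}+\int_0^1\frac{(\xi^s\circ\Phi)'(q)}{b^s-d^s(q)}\,dq\Big]-\frac12\int_0^1\zeta([0,q])(\theta\circ\Phi)'(q)\,dq,$$ and $\mathscr P(\zeta,\Phi)=\inf_{\boldsymbol b}A(\zeta,\Phi,\boldsymbol b)$ over all such $\boldsymbol b$. Pseudometric: with the quantile function $Q_\zeta(z)=\inf\{q\ge0:\zeta([0,q])\ge z\}$, $z\in[0,1]$, $$\mathcal D\big((\zeta_1,\Phi_1),(\zeta_2,\Phi_2)\big)=\int_0^1\|\Phi_1(Q_{\zeta_1}(z))-\Phi_2(Q_{\zeta_2}(z))\|_1\,dz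 .$$ *)

(* Defs.v *)
From HB Require Import structures.
From mathcomp Require Export all_boot all_order all_algebra.
From mathcomp Require Export all_classical all_reals all_analysis.

Set Implicit Arguments.
Unset Strict Implicit.
Unset Printing Implicit Defensive.

Import Order.TTheory GRing.Theory Num.Theory.
Import numFieldNormedType.Exports.

Local Open Scope classical_set_scope.
Local Open Scope ring_scope.

Section multispecies.
Context {R : realType} {S : finType}.

Definition partial (f : (S -> R) -> R) (s : S) (q : S -> R) : R :=
  derive1 (fun t : R => f (fun s' => if s' == s then t else q s')) (q s).

(* The argument [Delta2 p] is the array Delta^2 indexed by S^p (not squared
   again below); only the indices p >= 1 are ever used. *)
Definition array_sum (Delta2 : forall p : nat, p.-tuple S -> R) (p : nat)
    (lambda q : S -> R) : R :=
  \sum_(t : p.-tuple S)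
    Delta2 p t * (\prod_(s <- t) lambda s) * (\prod_(s <- t) q s).

Definition symmetric_array (p : nat) (a : p.-tuple S -> R) : Prop :=
  forall t u : p.-tuple S, perm_eq t u -> a t = a u.

Section covariance.
Variables (lambda : S -> R) (beta : nat -> R)
  (Delta2 : forall p : nat, p.-tuple S -> R).

(* The power series is not restricted to [-1, 1]^S: under [decay_condition] it
   converges on [-(1 + eps), 1 + eps]^S, so the partial derivatives below make
   sense at every point of [-1, 1]^S, including the boundary. *)
Definition xi (q : S -> R) : R :=
  \big[+%R/0]_(1 <= p <oo) (beta p ^+ 2 * array_sum Delta2 p lambda q).

Definition xi_s (s : S) (q : S -> R) : R := (lambda s)^-1 * partial xi s q.

Definition theta (q : S -> R) : R := \sum_(s : S) q s * partial xi s q - xi q.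

Definition decay_condition : Prop :=
  exists2 eps : R, 0 < eps &
    (\sum_(1 <= p <oo) (beta p ^+ 2 * (1 + eps) ^+ p *
       array_sum Delta2 p lambda (fun=> 1))%:E < +oo)%E.

Definition C_star : R :=
  sup [set partial (xi_s ss.1) ss.2 (fun=> 1) | ss in [set: S * S]].

End covariance.

(* Only the restriction of Phi to [0, 1] is meaningful. *)
Definition admissible_map (lambda : S -> R) (Phi : R -> S -> R) : Prop :=
  [/\ (forall q s, q \in `[0, 1] -> Phi q s \in `[0, 1]),
      (forall s, {within `[0, 1], continuous (fun q => Phi q s)}),
      (forall s, {in `[0, 1] &, {homo (fun q => Phi q s) : x y / x <= y}}) &
      (forall q, q \in `[0, 1] -> \sum_(s : S) lambda s * Phi q s = q)].

(* A Borel probability measure on [0, 1] is one on R that gives [0, 1] full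
   mass. *)
Definition admissible_pair (lambda : S -> R)
    (zeta : probability (measurableTypeR R) R) (Phi : R -> S -> R) : Prop :=
  zeta `[0, 1]%classic = 1%E /\ admissible_map lambda Phi.

Definition cdf01 (zeta : probability (measurableTypeR R) R) (u : R) : R :=
  fine (zeta `[0, u]%classic).

Section Parisi.
Variables (lambda : S -> R) (beta : nat -> R)
  (Delta2 : forall p : nat, p.-tuple S -> R).
Variables (zeta : probability (measurableTypeR R) R) (Phi : R -> S -> R).

Local Notation mu := (@lebesgue_measure R).
Local Notation xi_s := (xi_s lambda beta Delta2).
Local Notation theta := (theta lambda beta Delta2).

(* [derive1] has an unspecified value where the derivative does not exist and,
   at 0 and 1, depends on Phi outside [0, 1]; these points form a null set and
   do not affect the integrals below. *)
Definition xi_s_Phi' (s : S) : R -> R := derive1 (fun q => xi_s s (Phi q)).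

Definition theta_Phi' : R -> R := derive1 (fun q => theta (Phi q)).

Definition d_s (s : S) (q : R) : R :=
  \int[mu]_(u in `[q, 1]) (cdf01 zeta u * xi_s_Phi' s u).

Definition Parisi_A (b : S -> R) : R :=
  \sum_(s : S) lambda s / 2 *
    (b s - 1 - ln (b s) + xi_s s (fun=> 0) / (b s - d_s s 0)
     + \int[mu]_(q in `[0, 1]) (xi_s_Phi' s q / (b s - d_s s q)))
  - 2^-1 * \int[mu]_(q in `[0, 1]) (cdf01 zeta q * theta_Phi' q).

Definition Parisi : R :=
  inf [set Parisi_A b | b in [set b : S -> R | forall s, 0 < b s /\ d_s s 0 < b s]].

End Parisi.

Definition quantile01 (zeta : probability (measurableTypeR R) R) (z : R) : R :=
  inf [set q : R | 0 <= q /\ z <= cdf01 zeta q].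

Definition pair_dist (zeta1 : probability (measurableTypeR R) R)
    (Phi1 : R -> S -> R) (zeta2 : probability (measurableTypeR R) R)
    (Phi2 : R -> S -> R) : R :=
  \int[@lebesgue_measure R]_(z in `[0, 1])
    (\sum_(s : S) `|Phi1 (quantile01 zeta1 z) s - Phi2 (quantile01 zeta2 z) s|).

End multispecies.

(* Main.v *)
From HB Require Import structures.
Require Import Defs.
From mathcomp Require Import measurable_realfun ring lra.

(** Write Y(z) = Phi(Q(z)) for z in [0, 1], Q being the quantile function of
    zeta, and X^s(z) = xi^s(Y(z)).  The functional A depends on (zeta, Phi) only
    through Y.  Indeed zeta([0, u]) is the measure of the set of z with
    z <= zeta([0, u]), so Fubini turns the integral of zeta([0, u]) g'(u) over
    [q, 1] into the integral over z of g(1) - g(max(q, Q(z)))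
    ([quantile_fubini]).  With g = xi^s o Phi this says d^s(q) = D(g(q)) with
    D(x) = int_0^1 (x1 - max(x, X^s(z))) dz and x1 = xi^s(1), and the
    substitution x = g(q) merges the two b-dependent fractions into
    int_0^x1 dx / (b - D(x)).  Up to the factor lambda^s / 2, species s
    contributes [free_energy] = b - 1 - log b + int_0^x1 dx / (b - D(x)), and
    the last term of A is the mean of (theta(Y(z)) - theta(1)) / 2
    ([Parisi_A_free_energy]).

    [free_energy] is jointly convex in (b, D).  At a stationary b2 for the
    second pair, its tangent hyperplane gives, for every b1,
    free_energy X2 b2 <= free_energy X1 b1 + int_0^1 (G(X1(z)) - G(X2(z))) dz,
    where G(y) = int_0^x1 w(x) max(x, y) dx and w = (b2 - D2)^-2.  Stationarity
    reads int w = 1 - 1 / b2 <= 1, which makes G nondecreasing and 1-Lipschitz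
    ([free_energy_envelope]).

    It remains to compare, for each z, the values at Y1(z) and Y2(z) of
    h = theta - sum_s lambda^s G^s(xi^s).  If q <= q' coordinatewise, both terms
    of h increase from q to q', and both increments are at most
    sum_s lambda^s (xi^s(q') - xi^s(q)) <= C_* |q' - q|_1, so |h(q') - h(q)| is
    at most that; general points are compared through their coordinatewise
    minimum ([theta_transport_lip]).  The bounds on xi^s and theta come from
    the nonnegativity of the coefficients of xi ([covariance_bounds]).

    Two analytic facts support this.  A nondecreasing Lipschitz function is the
    integral of its almost everywhere derivative ([lipschitz_FTC], through
    Radon-Nikodym and Lebesgue differentiation).  The Lebesgue integral, as a
    supremum over simple functions, only depends on the integrand almost
    everywhere even when that integrand is not measurable
    ([ae_eq_integral_nonmeasurable]); this is what gives a value to the integrals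
    in which [derive1] occurs. *)

Set Implicit Arguments.
Unset Strict Implicit.
Unset Printing Implicit Defensive.

Import Order.TTheory GRing.Theory Num.Theory.
Import numFieldNormedType.Exports.
Local Open Scope classical_set_scope.
Local Open Scope ring_scope.

(** * Integrals and almost everywhere equality *)

Section null_modification.
Context d (T : measurableType d) (R : realType).
Variable mu : {measure set T -> \bar R}.

Import HBNNSimple.
Local Open Scope ereal_scope.

Let le_nnint (f g : T -> \bar R) (N : set T) : measurable N -> mu N = 0 ->
  (forall x, 0 <= f x) -> (forall x, 0 <= g x) ->
  (forall x, ~ N x -> f x <= g x) ->
  \int[mu]_x f x <= \int[mu]_x g x.
Proof.
move=> mN N0 f0 g0 fg; rewrite [leLHS]ge0_integralTE//.
apply: ge_ereal_sup => _ [h /= hf <-].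
pose h' : {nnsfun T >-> R} := proj_nnsfun h (measurableC mN).
rewrite [leRHS]ge0_integralTE//.
suff -> : sintegral mu h = sintegral mu h'.
  apply: ereal_sup_ubound; exists h' => //= x.
  rewrite /h' /= mindicE; have [|] := boolP (x \in ~` N).
    by rewrite inE mulr1 => /fg; apply: le_trans; exact: hf.
  by rewrite mulr0.
rewrite -!integralT_nnsfun; apply: ge0_ae_eq_integral => //.
- by apply/measurable_EFinP.
- by apply/measurable_EFinP.
- by move=> x _; rewrite lee_fin.
- by move=> x _; rewrite lee_fin.
- exists N; split=> // x /= hx; apply: contrapT => Nx; apply: hx => _.
  by rewrite /h' /= mindicE mem_set// mulr1.
Qed.

(** A simple function below [f] can be set to 0 on the exceptional null set; it
    is then below [g] and has the same integral.  Only simple functions are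
    integrated here, so [f] and [g] may be arbitrary. *)
Lemma ae_eq_integral_nonmeasurable (D : set T) (f g : T -> \bar R) :
  {ae mu, forall x, D x -> f x = g x} ->
  \int[mu]_(x in D) f x = \int[mu]_(x in D) g x.
Proof.
move=> [N [mN N0 fgN]].
have fg x : ~ N x -> (f \_ D) x = (g \_ D) x.
  move=> Nx; rewrite !patchE; case: ifPn => // xD.
  by apply: contrapT => h; apply: Nx; apply: fgN => /= /(_ (set_mem xD)).
rewrite integral_mkcond [RHS]integral_mkcond integralE [RHS]integralE.
by congr (_ - _); apply/eqP; rewrite eq_le; apply/andP; split;
  apply: (le_nnint mN N0) => // x /fg; rewrite ?funeposE ?funenegE => ->.
Qed.

End null_modification.

Section ae_itv.
Context (R : realType).
Notation mu := (@lebesgue_measure R).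

Lemma ae_eq_Rintegral_itv (a b : R) (F G : R -> R) :
  {ae mu, forall x : R, a < x < b -> F x = G x} ->
  \int[mu]_(x in `[a, b]) F x = \int[mu]_(x in `[a, b]) G x.
Proof.
move=> FG; rewrite /Rintegral; congr (fine _); apply: ae_eq_integral_nonmeasurable.
have ae1 c : {ae mu, forall x : R, x != c}.
  exists [set c]; split => //; first exact: lebesgue_measure_set1.
  by move=> x /= /negP; rewrite negbK => /eqP.
move: FG (ae1 a) (ae1 b); apply: filterS3; first exact: (ae_filter_ringOfSetsType mu).
move=> x FGx xa xb /=; rewrite in_itv/= => /andP[ax bx].
by rewrite FGx// !lt_neqAle ax bx eq_sym xa xb.
Qed.
End ae_itv.

(** * Integration over compact intervals *)

Section integral_toolbox.
Context (R : realType).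
Notation mu := (@lebesgue_measure R).

Lemma integrable_itv_bounded (a b M : R) (f : R -> R) :
  measurable_fun `[a, b] f -> (forall x, a <= x <= b -> `|f x| <= M) ->
  mu.-integrable `[a, b] (EFin \o f).
Proof.
move=> mf fM; apply: measurable_bounded_integrable => //.
  by rewrite /= lebesgue_measure_itv/=; case: ifP => _; rewrite -?EFinD ltry.
exists M; split; first exact: num_real.
by move=> x Mx t /=; rewrite in_itv/= => /fM /le_trans; apply; exact: ltW.
Qed.

Lemma measurable_nondecreasing_itv (a b : R) (f : R -> R) :
  (forall x y, a <= x -> x <= y -> y <= b -> f x <= f y) ->
  measurable_fun `[a, b] f.
Proof.
move=> fnd; have [ab|ba] := leP a b; last first.
  by rewrite set_itv_ge ?bnd_simp -?ltNge//; exact: measurable_fun_set0.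
pose cl x : R := Num.min (Num.max x a) b.
apply: (@eq_measurable_fun _ _ _ _ _ (f \o cl)).
  by move=> x; rewrite inE/= in_itv/= => /andP[ax xb]; rewrite /cl max_l// min_l.
apply: nondecreasing_measurable => // x y xy /=; apply: fnd.
- by rewrite le_min le_max lexx orbT.
- rewrite /cl le_min ge_min; apply/andP; split; last by rewrite ge_min lexx orbT.
  by rewrite ge_max !le_max xy lexx orbT.
- by rewrite ge_min lexx orbT.
Qed.

Lemma integrable_nondecreasing_itv (a b : R) (f : R -> R) :
  (forall x y, a <= x -> x <= y -> y <= b -> f x <= f y) ->
  mu.-integrable `[a, b] (EFin \o f).
Proof.
move=> fnd; apply: (@integrable_itv_bounded _ _ (`|f a| + `|f b|)).
  exact: measurable_nondecreasing_itv.
move=> x /andP[ax xb].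
have := fnd _ _ (lexx a) ax xb; have := fnd _ _ ax xb (lexx b).
have := ler_norm (f b); have := ler_norm (- f a); rewrite normrN.
have := normr_ge0 (f a); have := normr_ge0 (f b).
rewrite ler_norml; lra.
Qed.

Lemma integrable_nonincreasing_itv (a b : R) (f : R -> R) :
  (forall x y, a <= x -> x <= y -> y <= b -> f y <= f x) ->
  mu.-integrable `[a, b] (EFin \o f).
Proof.
move=> fni.
have : mu.-integrable `[a, b] (EFin \o (fun x => - f x)).
  by apply: integrable_nondecreasing_itv => x y ? ? ?; rewrite lerN2 fni.
move/integrableN; apply: eq_integrable => // x _ /=.
by rewrite opprK.
Qed.

Lemma integrable_itvB (a b : R) (f g : R -> R) :
  mu.-integrable `[a, b] (EFin \o f) -> mu.-integrable `[a, b] (EFin \o g) ->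
  mu.-integrable `[a, b] (EFin \o (fun x => f x - g x)).
Proof.
move=> fi gi.
have : mu.-integrable `[a, b] ((EFin \o f) \- (EFin \o g))%E.
  by apply: integrableB.
by apply: eq_integrable.
Qed.

Lemma integrable_itvD (a b : R) (f g : R -> R) :
  mu.-integrable `[a, b] (EFin \o f) -> mu.-integrable `[a, b] (EFin \o g) ->
  mu.-integrable `[a, b] (EFin \o (fun x => f x + g x)).
Proof.
move=> fi gi.
have : mu.-integrable `[a, b] ((EFin \o f) \+ (EFin \o g))%E.
  by apply: integrableD.
by apply: eq_integrable.
Qed.

Lemma integrable_itvZ (a b k : R) (f : R -> R) :
  mu.-integrable `[a, b] (EFin \o f) ->
  mu.-integrable `[a, b] (EFin \o (fun x => k * f x)).
Proof.
move=> fi.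
have : mu.-integrable `[a, b] (fun x => k%:E * (f x)%:E)%E.
  exact: (integrableZl _ k fi).
by apply: eq_integrable.
Qed.

Lemma Rintegral_itv_cst (a b c : R) : a <= b ->
  \int[mu]_(x in `[a, b]) c = c * (b - a).
Proof.
move=> ab; rewrite Rintegral_cst//= lebesgue_measure_itv/= lte_fin.
case: ltP => [_|ba]; first by rewrite -EFinD.
by rewrite (@le_anti _ _ a b) ?ab// subrr.
Qed.

Lemma le_Rintegral_itv (a b : R) (f g : R -> R) :
  mu.-integrable `[a, b] (EFin \o f) -> mu.-integrable `[a, b] (EFin \o g) ->
  (forall x, a <= x <= b -> f x <= g x) ->
  \int[mu]_(x in `[a, b]) f x <= \int[mu]_(x in `[a, b]) g x.
Proof. by move=> fi gi fg; apply: le_Rintegral. Qed.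

Lemma Rintegral_itv_ge0 (a b : R) (f : R -> R) :
  (forall x, a <= x <= b -> 0 <= f x) -> 0 <= \int[mu]_(x in `[a, b]) f x.
Proof. by move=> f0; apply: Rintegral_ge0. Qed.

Lemma measurable_setX_fst (A B : set R) (f : R -> R) :
  measurable A -> measurable B -> measurable_fun A f ->
  measurable_fun (A `*` B) (fun p => f p.1).
Proof.
move=> mA mB mf; apply: (measurable_comp mA) => //; first by move=> _ [[x y] [/= Ax _] <-].
exact: measurable_funTS.
Qed.

Lemma measurable_setX_snd (A B : set R) (f : R -> R) :
  measurable A -> measurable B -> measurable_fun B f ->
  measurable_fun (A `*` B) (fun p => f p.2).
Proof.
move=> mA mB mf; apply: (measurable_comp mB) => //; first by move=> _ [[x y] [/= _ By] <-].
exact: measurable_funTS.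
Qed.

Lemma Rintegral_fubini (a b c d : R) (h : R -> R -> R) :
  measurable_fun (`[a, b] `*` `[c, d]) (fun p => h p.1 p.2) ->
  (forall x y, a <= x <= b -> c <= y <= d -> 0 <= h x y) ->
  (forall x, a <= x <= b -> mu.-integrable `[c, d] (EFin \o h x)) ->
  (forall y, c <= y <= d -> mu.-integrable `[a, b] (EFin \o h^~ y)) ->
  \int[mu]_(x in `[a, b]) (\int[mu]_(y in `[c, d]) h x y) =
  \int[mu]_(y in `[c, d]) (\int[mu]_(x in `[a, b]) h x y).
Proof.
move=> mh h0 hi1 hi2; rewrite /Rintegral; congr (fine _).
transitivity (\int[mu]_(x in `[a, b]) \int[mu]_(y in `[c, d]) (h x y)%:E)%E.
  apply: eq_integral => x; rewrite inE/= in_itv/= => xab.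
  by rewrite fineK//; apply: integrable_fin_num => //; exact: hi1.
transitivity (\int[mu]_(y in `[c, d]) \int[mu]_(x in `[a, b]) (h x y)%:E)%E; last first.
  apply: eq_integral => x; rewrite inE/= in_itv/= => xab.
  by rewrite fineK//; apply: integrable_fin_num => //; exact: hi2.
pose k := (EFin \o (fun p : R * R => h p.1 p.2)) \_ (`[a, b] `*` `[c, d]).
have mD : measurable (`[a, b] `*` `[c, d] : set (R * R)) by exact: measurableX.
have kE x y : k (x, y) = ((h x y)%:E *+ ((x \in `[a, b]) && (y \in `[c, d])))%R.
  rewrite /k patchE; case: ifPn.
    by rewrite inE => -[/= -> ->].
  by rewrite notin_setE/= => nD; case: andP => // -[hx hy]; case: nD.
have itvE (u v t : R) : (t \in (`[u, v]%classic : set R)) = (t \in `[u, v]).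
  by apply/idP/idP; rewrite inE.
transitivity (\int[mu]_x \int[mu]_y k (x, y))%E.
  rewrite integral_mkcond; apply: eq_integral => x _.
  rewrite patchE itvE; case: ifPn => xab.
    rewrite integral_mkcond; apply: eq_integral => y _.
    by rewrite kE patchE itvE xab; case: (y \in `[c, d]).
  by rewrite integral0_eq// => y _; rewrite kE (negbTE xab).
rewrite fubini_tonelli; last 2 first.
- apply/measurable_restrict => //; rewrite setTI.
  exact/measurable_EFinP.
- move=> [x y]; rewrite kE; case: (boolP (_ && _)) => //= /andP[].
  by rewrite !in_itv/= => xab ycd; rewrite lee_fin h0.
rewrite [RHS]integral_mkcond; apply: eq_integral => y _.
rewrite patchE itvE; case: ifPn => ycd.
  rewrite [RHS]integral_mkcond; apply: eq_integral => x _.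
  by rewrite kE patchE itvE ycd andbT; case: (x \in `[a, b]).
by rewrite integral0_eq// => x _; rewrite kE (negbTE ycd) andbF.
Qed.

Lemma Rintegral_itv_sum (I : Type) (r : seq I) (a b : R) (f : I -> R -> R) :
  (forall i, mu.-integrable `[a, b] (EFin \o f i)) ->
  mu.-integrable `[a, b] (EFin \o (fun x => \sum_(i <- r) f i x)) /\
  \int[mu]_(x in `[a, b]) (\sum_(i <- r) f i x) =
    \sum_(i <- r) \int[mu]_(x in `[a, b]) f i x.
Proof.
move=> fi; elim: r => [|i r [ih1 ih2]].
  split.
    by apply: integrable_nondecreasing_itv => x y _ _ _; rewrite !big_nil.
  under eq_Rintegral do rewrite big_nil.
  by rewrite big_nil Rintegral_cst// mul0r.
split.
  have := integrable_itvD (fi i) ih1.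
  by apply: eq_integrable => // x _ /=; rewrite big_cons.
under eq_Rintegral do rewrite big_cons.
by rewrite RintegralD// ih2 big_cons.
Qed.

(** Stated for abstract integrands, and with the values [s2] and [s4] of two of
    the integrals as parameters, so that finite sums of integrals can be
    substituted for them. *)
Lemma Rintegral_itv_diff_le (a b C s2 s4 : R) (f1 f2 f3 f4 f5 : R -> R) :
  mu.-integrable `[a, b] (EFin \o f1) -> mu.-integrable `[a, b] (EFin \o f2) ->
  mu.-integrable `[a, b] (EFin \o f3) -> mu.-integrable `[a, b] (EFin \o f4) ->
  mu.-integrable `[a, b] (EFin \o f5) ->
  \int[mu]_(x in `[a, b]) f2 x = s2 -> \int[mu]_(x in `[a, b]) f4 x = s4 ->
  (forall x, a <= x <= b -> (f1 x - f2 x) - (f3 x - f4 x) <= C * f5 x) ->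
  (\int[mu]_(x in `[a, b]) f1 x - s2) - (\int[mu]_(x in `[a, b]) f3 x - s4) <=
  C * \int[mu]_(x in `[a, b]) f5 x.
Proof.
move=> i1 i2 i3 i4 i5 <- <- le.
have i12 := integrable_itvB i1 i2; have i34 := integrable_itvB i3 i4.
have i14 := integrable_itvB i12 i34; have iC := integrable_itvZ C i5.
rewrite -RintegralB// -RintegralB// -RintegralB// -RintegralZl//.
exact: le_Rintegral_itv.
Qed.

End integral_toolbox.

(** * The fundamental theorem of calculus for nondecreasing Lipschitz functions *)

Section lipschitz_density.
Context (R : realType).
Notation mu := (@lebesgue_measure R).

Lemma nondecreasing_lip_continuous (L : R) (g : R -> R) :
  (forall x y : R, x <= y -> 0 <= g y - g x <= L * (y - x)) -> continuous g.
Proof.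
move=> glip x; apply/cvgrPdist_le => /= e e0.
have L0 : 0 < `|L| + 1 by rewrite ltr_wpDl.
have LL : L <= `|L| + 1 by rewrite (le_trans (ler_norm _))// lerDl.
have eL : 0 < e / (`|L| + 1) by rewrite divr_gt0.
have key u v : u <= v -> `|u - v| * (`|L| + 1) <= e -> `|g u - g v| <= e.
  move=> uv uve; have /andP[g1 g2] := glip _ _ uv.
  rewrite distrC ger0_norm// (le_trans g2)// (le_trans _ uve)//.
  by rewrite distrC ger0_norm ?subr_ge0// mulrC ler_wpM2l// subr_ge0.
near=> y.
have : `|x - y| <= e / (`|L| + 1).
  by near: y; apply: cvgr_dist_le => //; exact: cvg_id.
rewrite ler_pdivlMr// => xye.
have [xy|/ltW yx] := leP x y; first exact: key.
by rewrite distrC key// distrC.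
Unshelve. all: end_near. Qed.

(** For a 1-Lipschitz nondecreasing [g], the function [x - g x] is nondecreasing
    too, and the Stieltjes measures of [g] and of [x - g x] add up to the Lebesgue
    measure.  Hence the Stieltjes measure of [g] is bounded by the Lebesgue
    measure and has a density. *)
Section cumul.
Variable g : R -> R.
Hypothesis glip : forall x y : R, x <= y -> 0 <= g y - g x <= y - x.

Let g_nd : nondecreasing g.
Proof. by move=> x y /glip /andP[]; rewrite subr_ge0. Qed.

Let g_rc : right_continuous g.
Proof.
apply/right_continuousW/(@nondecreasing_lip_continuous 1) => x y xy.
by rewrite mul1r; exact: glip.
Qed.

HB.instance Definition _ := isCumulative.Build R _ R g g_nd g_rc.

Let h x := x - g x.

Let hlip x y : x <= y -> 0 <= h y - h x <= y - x.
Proof. by rewrite /h => /glip; lra. Qed.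

Let h_nd : nondecreasing h.
Proof. by move=> x y /hlip /andP[]; rewrite subr_ge0. Qed.

Let h_rc : right_continuous h.
Proof.
apply/right_continuousW/(@nondecreasing_lip_continuous 1) => x y xy.
by rewrite mul1r; exact: hlip.
Qed.

HB.instance Definition _ := isCumulative.Build R _ R h h_nd h_rc.

Let LS : {measure set (measurableTypeR R) -> \bar R} :=
  lebesgue_stieltjes_measure g.

Let LSoc (f : cumulative R R) a b : a <= b ->
  lebesgue_stieltjes_measure f `]a, b]%classic = (f b - f a)%:E.
Proof.
move=> ab.
rewrite /lebesgue_stieltjes_measure /measure_extension.
rewrite measurable_mu_extE/=; last exact: is_ocitv.
by rewrite wlength_itv_bnd.
Qed.

Let LS_le A : measurable A -> (LS A <= mu A)%E.
Proof.
move=> mA.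
pose m : {measure set (measurableTypeR R) -> \bar R} :=
  measure_add LS (lebesgue_stieltjes_measure h).
have mE B : m B = (LS B + lebesgue_stieltjes_measure h B)%E.
  exact: measure_addE.
have -> : mu A = m A.
  apply: lebesgue_measure_unique => // _ [[a b] _ <-] /=.
  have [ab|ba] := leP a b; last by rewrite set_itv_ge ?measure0// bnd_simp -leNgt ltW.
  rewrite mE /lebesgue_measure (LSoc _ ab) (LSoc h ab).
  have -> : LS `]a, b]%classic = (g b - g a)%:E by exact: LSoc.
  rewrite -EFinD; congr (_%:E).
  by change (b - a = g b - g a + ((b - g b) - (a - g a))); ring.
by rewrite mE leeDl.
Qed.

Lemma lipschitz1_density : exists f : R -> R,
  [/\ forall x, 0 <= f x, mu.-integrable setT (EFin \o f) &
    forall x y : R, 0 <= x -> x <= y -> y <= 1 ->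
      \int[mu]_(t in `[x, y]) f t = g y - g x].
Proof.
have m01 : measurable (`[0, 1]%classic : set (measurableTypeR R)) by [].
have fin01 : (LS `[0%R, 1%R]%classic < +oo)%E.
  apply: le_lt_trans (LS_le m01) _.
  by rewrite lebesgue_measure_itv/= lte01 -EFinB ltry.
pose nu : {finite_measure set (measurableTypeR R) -> \bar R} := mfrestr m01 fin01.
have nuE A : nu A = LS (A `&` `[0, 1]) by [].
have numu : nu `<< mu.
  move=> A A0 B mB BA; apply/eqP; rewrite -measure_le0.
  suff : (LS (B `&` `[0%R, 1%R]) <= 0)%E by [].
  have mBI : measurable (B `&` `[0, 1]) by exact: measurableI.
  by rewrite (le_trans (LS_le mBI))// A0// => x [/BA].
have [f [f0 ffin fi fE]] := radon_nikodym_sigma_finite numu.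
have fi' : mu.-integrable setT (EFin \o (fine \o f)).
  by apply: eq_integrable fi => // x _ /=; rewrite fineK.
exists (fine \o f); split => //.
- by move=> x; rewrite fine_ge0.
- move=> x y x0 xy y1.
  rewrite -Rintegral_itv_obnd_cbnd; last exact: integrableS fi'.
  rewrite /Rintegral; under eq_integral do rewrite /= fineK//.
  rewrite -fE// nuE setIidl; first by rewrite [LS _]LSoc.
  move=> t /=; rewrite !in_itv/= => /andP[/ltW xt ty].
  by rewrite (le_trans x0 xt) (le_trans ty y1).
Qed.
End cumul.

(** The density of the Stieltjes measure is the derivative at its Lebesgue
    points, that is, almost everywhere. *)
Lemma lipschitz_FTC (g : R -> R) (L : R) :
  (forall x y : R, 0 <= x -> x <= y -> y <= 1 -> 0 <= g y - g x <= L * (y - x)) ->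
  exists f : R -> R, [/\ forall x, 0 <= f x, mu.-integrable setT (EFin \o f),
    forall x y : R, 0 <= x -> x <= y -> y <= 1 ->
      \int[mu]_(t in `[x, y]) f t = g y - g x &
    {ae mu, forall x : R, 0 < x < 1 -> derivable g x 1 /\ derive1 g x = f x}].
Proof.
move=> glip.
(* The function is extended by constants outside [0, 1] and rescaled to be
   1-Lipschitz; the added 1 keeps the factor positive when L = 0. *)
pose M := `|L| + 1.
have M0 : 0 < M by rewrite ltr_wpDl.
have LM : L <= M by rewrite (le_trans (ler_norm _))// lerDl.
pose cl (x : R) : R := Num.min (Num.max x 0) 1.
have cl_id (x : R) : 0 <= x <= 1 -> cl x = x.
  by move=> /andP[x0 x1]; rewrite /cl max_l// min_l.
have cl0 (x : R) : 0 <= cl x by rewrite le_min le_max lexx orbT ler01.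
have cl1 (x : R) : cl x <= 1 by rewrite ge_min lexx orbT.
have clD (x y : R) : x <= y -> 0 <= cl y - cl x <= y - x.
  rewrite /cl; case: (leP x 0); case: (leP y 0); case: (leP x 1);
    case: (leP y 1); case: (leP (0 : R) 1) => *; lra.
pose g1 (x : R) : R := g (cl x) / M.
have g1lip (x y : R) : x <= y -> 0 <= g1 y - g1 x <= y - x.
  move=> /clD /andP[c0 c1]; rewrite /g1 -mulrBl.
  have /andP[gl gu] := glip (cl x) (cl y) (cl0 _) ltac:(by rewrite -subr_ge0) (cl1 _).
  rewrite divr_ge0 ?(ltW M0)//= ler_pdivrMr// (le_trans gu)//.
  by rewrite (le_trans (ler_wpM2r c0 LM))// mulrC ler_wpM2r// ltW.
have [f [f0 fi fE]] := lipschitz1_density g1lip.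
have Mfi : mu.-integrable setT (EFin \o (fun x => M * f x)).
  by have := integrableZl measurableT M fi; apply: eq_integrable => // x _ /=; rewrite EFinM.
have fE' (x y : R) : 0 <= x -> x <= y -> y <= 1 ->
    \int[mu]_(t in `[x, y]) (M * f t) = g y - g x.
  move=> x0 xy y1; rewrite RintegralZl//; last exact: integrableS fi.
  rewrite fE// /g1 !cl_id; [|by rewrite x0 (le_trans xy)|by rewrite (le_trans x0 xy)].
  by rewrite -mulrBl mulrC divfK// gt_eqF.
exists (fun x => M * f x); split => //.
  by move=> x; rewrite mulr_ge0// ltW.
have := @FTC1 _ (fun x => M * f x) (BLeft 0) _ (open_integrable_locally openT Mfi).
have Mfi0 y : mu.-integrable [set` Interval (BLeft (0 : R)) (BRight y)]
    (EFin \o (fun x => M * f x)).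
  exact: integrableS Mfi.
move=> /(_ Mfi0); apply: filterS; first exact: (ae_filter_ringOfSetsType mu).
move=> x dFE /andP[x0 x1].
have [dF dE] := dFE x0.
have near_g : {near x, (fun y => \int[mu]_(t in `[0, y]) (M * f t) + g 0) =1 g}.
  have x01 : x \in `]0, 1[ by rewrite in_itv/= x0.
  near=> y.
  have : y \in `]0, 1[ by near: y; exact: near_in_itvoo x01.
  by rewrite in_itv/= => /andP[/ltW y0 /ltW y1]; rewrite fE' ?subrK.
have idF : is_derive x (1:R) (fun y => \int[mu]_(t in `[0, y]) (M * f t)) (M * f x).
  by split; [exact: dF|rewrite -derive1E].
have dG : is_derive x (1:R) (fun y => \int[mu]_(t in `[0, y]) (M * f t) + g 0) (M * f x).
  by rewrite -[M * f x]addr0; apply: is_deriveD.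
have idg : is_derive x (1:R) g (M * f x).
  by apply: (near_eq_is_derive _ dG); rewrite ?oner_eq0.
by case: idg => dg Dg; split; [exact: dg|rewrite derive1E].
Unshelve. all: end_near. Qed.
End lipschitz_density.

(** * Quantiles *)

Section quantile.
Context (R : realType).
Notation mu := (@lebesgue_measure R).
Variable zeta : probability (measurableTypeR R) R.
Hypothesis zeta01 : zeta `[0, 1]%classic = 1%E.

Local Notation F := (cdf01 zeta).
Local Notation Q := (quantile01 zeta).

Lemma cdf01_ge0 u : 0 <= F u.
Proof. exact: fine_ge0. Qed.

Lemma cdf01_nd u v : u <= v -> F u <= F v.
Proof.
move=> uv; rewrite /cdf01 fine_le//; rewrite ?fin_num_measure//.
apply: le_measure; rewrite ?inE//; apply: subset_itvl.
by rewrite bnd_simp.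
Qed.

Lemma cdf01_le1 u : F u <= 1.
Proof.
rewrite /cdf01 -lee_fin fineK ?fin_num_measure//.
exact: probability_le1.
Qed.

Lemma cdf01_1 : F 1 = 1.
Proof. by rewrite /cdf01 zeta01. Qed.

Lemma measurable_cdf01 (D : set R) : measurable D -> measurable_fun D F.
Proof. by move=> mD; apply: nondecreasing_measurable => // x y; exact: cdf01_nd. Qed.

Let Qset z := [set q : R | 0 <= q /\ z <= F q].

Let Qinf z : z <= 1 -> has_inf (Qset z).
Proof.
move=> z1; split; first by exists 1; split => //; rewrite cdf01_1.
by exists 0 => x [].
Qed.

Lemma quantile_ge0 z : z <= 1 -> 0 <= Q z.
Proof. by move=> z1; apply: lb_le_inf; [exact: (Qinf z1).1|move=> x []]. Qed.

Lemma quantile_le z q : 0 <= q -> z <= F q -> Q z <= q.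
Proof. by move=> q0 zq; apply: ge_inf; [exists 0 => x []|]. Qed.

Lemma quantile_le1 z : z <= 1 -> Q z <= 1.
Proof. by move=> z1; apply: quantile_le => //; rewrite cdf01_1. Qed.

Lemma quantile_lt z q : z <= 1 -> Q z < q -> z <= F q.
Proof.
move=> z1 /(inf_lt (Qinf z1).1) [x [x0 zx] /ltW xq].
exact: le_trans zx (cdf01_nd xq).
Qed.

Lemma quantile_nd z z' : z <= z' -> z' <= 1 -> Q z <= Q z'.
Proof.
move=> zz' z1; apply: lb_le_inf; first exact: (Qinf z1).1.
by move=> x [x0 z'x]; apply: quantile_le => //; exact: le_trans z'x.
Qed.


Lemma measurable_le_bool (d : measure_display) (T : measurableType d)
    (D : set T) (f g : T -> R) : measurable_fun D f -> measurable_fun D g ->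
  measurable_fun D (fun x => (f x <= g x)%R%:R : R).
Proof.
move=> mf mg mD.
rewrite (_ : (fun x => _) = (fun x => if f x <= g x then 1 else 0)).
  by apply: measurable_fun_if => //; exact: measurable_fun_ler.
by apply/funext => x; case: (f x <= g x).
Qed.

Lemma cdf01_Rintegral u :
  \int[mu]_(z in `[0, 1]) (z <= F u)%R%:R = F u.
Proof.
transitivity (\int[mu]_(z in `[0, 1]) (\1_(`[0, F u]%classic : set R) z : R)).
  apply: eq_Rintegral => z; rewrite inE/= in_itv/= => /andP[z0 _].
  rewrite indicE; congr (_%:R); congr nat_of_bool.
  by apply/idP/idP; rewrite inE/= in_itv/= z0.
rewrite /Rintegral integral_indic//= setIidl; last first.
  by apply: subset_itvl; rewrite bnd_simp cdf01_le1.
rewrite lebesgue_measure_itv/= lte_fin; case: ltP => /=; first by rewrite subr0.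
by move=> F0; apply/eqP; rewrite eq_le cdf01_ge0.
Qed.

(** Layer cake: [F u] is the measure of the set of [z] with [z <= F u].  For a
    fixed [z], the set of [u] with [z <= F u] is the half-line from [Q z] on, up to
    the single point [Q z], where the infimum may or may not be attained. *)
Lemma quantile_fubini (f g : R -> R) (q : R) :
  (forall x, 0 <= f x) -> mu.-integrable setT (EFin \o f) ->
  (forall x y, 0 <= x -> x <= y -> y <= 1 ->
      \int[mu]_(t in `[x, y]) f t = g y - g x) ->
  0 <= q <= 1 ->
  \int[mu]_(u in `[q, 1]) (F u * f u) =
  \int[mu]_(z in `[0, 1]) (g 1 - g (Num.max q (Q z))).
Proof.
move=> f0 fi fg /andP[q0 q1].
have mf D : measurable D -> measurable_fun D f.
  by move=> mD; apply: measurable_funTS; apply/measurable_EFinP; exact: measurable_int fi.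
have mf1 x : mu.-integrable setT (EFin \o (fun u => f u * (x <= F u)%R%:R)).
  apply: (le_integrable _ _ _ fi) => //.
    apply/measurable_EFinP; apply: measurable_funM; first exact: mf.
    by apply: measurable_le_bool => //; exact: measurable_cdf01.
  move=> u _ /=; rewrite lee_fin normrM ler_piMr// ger0_norm ?ler0n//.
  by case: (x <= F u).
transitivity (\int[mu]_(u in `[q, 1]) \int[mu]_(z in `[0, 1]) (f u * (z <= F u)%R%:R)).
  apply: eq_Rintegral => u _; rewrite RintegralZl//.
    by rewrite cdf01_Rintegral mulrC.
  apply: (@integrable_itv_bounded _ _ _ 1).
    by apply: measurable_le_bool => //; exact: measurable_cst.
  by move=> z _; rewrite ger0_norm ?ler0n//; case: (z <= F u).
rewrite Rintegral_fubini.
- apply: eq_Rintegral => z; rewrite inE/= in_itv/= => /andP[z0 z1].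
  set m := Num.max q (Q z).
  have qm : q <= m by rewrite le_max lexx.
  have m1 : m <= 1 by rewrite ge_max q1 quantile_le1.
  rewrite -fg ?(le_trans q0)//.
  have i1 (a b : itv_bound R) : mu.-integrable [set` Interval a b]
      (EFin \o (fun u => f u * (z <= F u)%R%:R)).
    exact: integrableS (mf1 z).
  rewrite -[LHS](subrK (\int[mu]_(u in `[q, m]) (f u * (z <= F u)%R%:R))).
  rewrite Rintegral_itvB// ?bnd_simp//.
  rewrite [X in _ + X](_ : _ = 0) ?addr0; last first.
    rewrite -Rintegral_itv_bndo_bndc//.
    transitivity (\int[mu]_(u in `[q, m[) (0 : R)); last by rewrite Rintegral_cst ?mul0r.
    apply: eq_Rintegral => u; rewrite inE/= in_itv/= => /andP[qu um].
    have zu : u < Q z by move: um; rewrite lt_max ltNge qu.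
    rewrite (_ : z <= F u = false) ?mulr0//; apply: contraTF zu => zu.
    by rewrite -leNgt quantile_le// (le_trans q0).
  rewrite -[RHS]Rintegral_itv_obnd_cbnd; last exact: integrableS fi.
  apply: eq_Rintegral => u; rewrite inE/= in_itv/= => /andP[mu1 _].
  have /quantile_lt -> : Q z < u by rewrite (le_lt_trans _ mu1)// le_max lexx orbT.
    by rewrite mulr1.
  by [].
- have mfst : measurable_fun (`[q, 1]%classic `*` `[0, 1]%classic : set (R * R)) fst.
    exact: measurable_funTS.
  have msnd : measurable_fun (`[q, 1]%classic `*` `[0, 1]%classic : set (R * R)) snd.
    exact: measurable_funTS.
  apply: measurable_funM; first by apply: measurableT_comp => //; exact: mf.
  apply: measurable_le_bool => //.
  by apply: measurableT_comp => //; exact: measurable_cdf01.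
- by move=> u z _ _; rewrite mulr_ge0.
- move=> u _; apply: (@integrable_itv_bounded _ _ _ (f u)).
    apply: measurable_funM => //.
    by apply: measurable_le_bool => //; exact: measurable_cst.
  move=> z _; rewrite normrM ger0_norm// ler_piMr// ger0_norm ?ler0n//.
  by case: (z <= F u).
- by move=> z _; exact: integrableS (mf1 z).
Qed.

End quantile.

(** * The one-species functional and its stationary point *)

Section envelope.
Context (R : realType).
Notation mu := (@lebesgue_measure R).
Variable x1 : R.
Hypothesis x1_ge0 : 0 <= x1.

Definition profile (X : R -> R) :=
  (forall z, 0 <= z <= 1 -> 0 <= X z <= x1) /\
  (forall z z', 0 <= z -> z <= z' -> z' <= 1 -> X z <= X z').

(** The function D of the introduction, that is, [d_s] read in the variable
    [x = xi_s (Phi q)].  When [X <= x1], it is the integral over [[x, x1]] of the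
    distribution function of [X]. *)
Definition tail (X : R -> R) (x : R) :=
  x1 - \int[mu]_(z in `[0, 1]) Num.max x (X z).

Definition free_energy (X : R -> R) (b : R) :=
  b - 1 - ln b + \int[mu]_(x in `[0, x1]) (b - tail X x)^-1.

Section tail.
Variable X : R -> R.
Hypothesis pX : profile X.

Lemma integrable_max x : mu.-integrable `[0, 1] (EFin \o (fun z => Num.max x (X z))).
Proof.
apply: integrable_nondecreasing_itv => z z' z0 zz' z'1.
rewrite ge_max !le_max lexx /=.
by rewrite (pX.2 _ _ z0 zz' z'1) orbT.
Qed.

Lemma tail_lip x y : x <= y -> 0 <= tail X x - tail X y <= y - x.
Proof.
move=> xy; rewrite /tail.
rewrite [X in 0 <= X](_ : _ = \int[mu]_(z in `[0, 1]) (Num.max y (X z) - Num.max x (X z))); last first.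
  by rewrite RintegralB//; [ring|exact: integrable_max..].
have ymx (z : R) : 0 <= Num.max y (X z) - Num.max x (X z) <= y - x.
  by case: (leP y (X z)); case: (leP x (X z)) => *; lra.
apply/andP; split.
  by apply: Rintegral_itv_ge0 => z _; have /andP[] := ymx z.
rewrite [leRHS](_ : _ = \int[mu]_(z in `[0, 1]) (y - x)); last first.
  by rewrite Rintegral_itv_cst// subr0 mulr1.
rewrite [leLHS](_ : _ = \int[mu]_(z in `[0, 1]) (Num.max y (X z) - Num.max x (X z))); last first.
  by rewrite RintegralB//; [ring|exact: integrable_max..].
apply: le_Rintegral_itv => //.
- by apply: integrable_itvB; exact: integrable_max.
- exact: integrable_nondecreasing_itv.
- by move=> z _; have /andP[] := ymx z.
Qed.

Lemma tail_ni x y : x <= y -> tail X y <= tail X x.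
Proof. by move=> /tail_lip /andP[]; rewrite subr_ge0. Qed.

Lemma tail_flat x y : (forall z, 0 <= z <= 1 -> x <= X z) ->
  (forall z, 0 <= z <= 1 -> y <= X z) -> tail X x = tail X y.
Proof.
move=> xX yX; rewrite /tail; congr (_ - _); apply: eq_Rintegral => z.
by rewrite inE/= in_itv/= => z01; rewrite !max_r ?xX ?yX.
Qed.

Lemma tail_ge0 x : x <= x1 -> 0 <= tail X x.
Proof.
move=> xx1; rewrite subr_ge0.
rewrite [leRHS](_ : _ = \int[mu]_(z in `[0, 1]) x1); last first.
  by rewrite Rintegral_itv_cst// subr0 mulr1.
apply: le_Rintegral_itv => //; first exact: integrable_max.
  exact: integrable_nondecreasing_itv.
by move=> z /pX.1 /andP[_ Xx1]; rewrite ge_max xx1.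
Qed.

Lemma tail_continuous : continuous (tail X).
Proof.
move=> x.
rewrite (_ : tail X = (fun x => - - tail X x)); last by apply/funext => y; rewrite opprK.
apply: cvgN; suff : continuous (fun y => - tail X y) by exact.
apply: (@nondecreasing_lip_continuous R 1) => {}x y /tail_lip.
by rewrite opprK addrC mul1r.
Qed.

Variable b : R.
Hypothesis bt : tail X 0 < b.

Lemma subr_tail_gt0 x : 0 <= x -> 0 < b - tail X x.
Proof. by move=> x0; rewrite subr_gt0 (le_lt_trans (tail_ni x0)). Qed.

Lemma inv_tail_ni x y : 0 <= x -> x <= y -> (b - tail X y)^-1 <= (b - tail X x)^-1.
Proof.
move=> x0 xy; rewrite lef_pV2 ?posrE ?subr_tail_gt0 ?(le_trans x0)//.
by rewrite lerD2l lerN2 tail_ni.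
Qed.

Lemma integrable_inv_tail n : mu.-integrable `[0, x1]
  (EFin \o (fun x => (b - tail X x)^-1 ^+ n)).
Proof.
apply: integrable_nonincreasing_itv => x y x0 xy _.
by rewrite lerXn2r ?nnegrE ?inv_tail_ni// invr_ge0 ltW// subr_tail_gt0// (le_trans x0).
Qed.

End tail.

Lemma subr_inv_bound (d u v : R) : 0 < d -> d <= u -> u <= v ->
  0 <= u^-1 - v^-1 <= (v - u) / d ^+ 2.
Proof.
move=> d0 du uv.
have u0 : 0 < u by exact: lt_le_trans du.
have v0 : 0 < v by exact: lt_le_trans uv.
have -> : u^-1 - v^-1 = (v - u) / (u * v) by field; rewrite !gt_eqF.
rewrite divr_ge0 ?subr_ge0 ?mulr_ge0 ?(ltW u0) ?(ltW v0)//=.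
rewrite ler_wpM2l ?subr_ge0// lef_pV2 ?posrE ?mulr_gt0 ?exprn_gt0//.
by rewrite expr2 ler_pM ?(ltW d0)// (le_trans du).
Qed.

Lemma subr_inv2_bound (d u v : R) : 0 < d -> d <= u -> u <= v ->
  0 <= u^-1 ^+ 2 - v^-1 ^+ 2 <= 2 * d^-1 ^+ 3 * (v - u).
Proof.
move=> d0 du uv.
have /andP[l1 l2] := subr_inv_bound d0 du uv.
have u0 : 0 < u by exact: lt_le_trans du.
have v0 : 0 < v by exact: lt_le_trans uv.
have ud : u^-1 <= d^-1 by rewrite lef_pV2.
have vd : v^-1 <= d^-1 by rewrite lef_pV2 ?posrE// (le_trans du).
have iu : 0 < u^-1 by rewrite invr_gt0.
have iv : 0 < v^-1 by rewrite invr_gt0.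
have uv0 : 0 <= u^-1 + v^-1 by rewrite addr_ge0 ?ltW.
rewrite subr_sqr (mulr_ge0 l1 uv0)/=.
have -> : 2 * d^-1 ^+ 3 * (v - u) = (v - u) / d ^+ 2 * (d^-1 + d^-1).
  by field; rewrite gt_eqF.
by apply: ler_pM => //; exact: lerD.
Qed.

(** The derivative of [free_energy X] in [b]. *)
Definition stationarity (X : R -> R) (b : R) :=
  1 - b^-1 - \int[mu]_(x in `[0, x1]) (b - tail X x)^-1 ^+ 2.

(** The intermediate value theorem between [tail X 0 + 1/4] and
    [tail X 0 + 2 + x1].  At the left end either [x1 <= 1/4], and [b <= 1/2] gives
    [1 - 1 / b <= -1], or the integrand is at least 4 on [[0, 1/4]] because [tail]
    is 1-Lipschitz, so that the integral is at least 1.  At the right end [1 / b]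
    and the integral are both at most 1/2. *)
Lemma exists_stationary X : profile X -> exists b,
  [/\ 0 < b, tail X 0 < b & stationarity X b = 0].
Proof.
move=> pX.
have D0 : 0 <= tail X 0 by exact: tail_ge0.
have D0x1 : tail X 0 <= x1.
  have := tail_lip pX x1_ge0; have := tail_ge0 pX (lexx x1).
  have : tail X x1 = 0.
    rewrite /tail (_ : \int[mu]_(z in _) _ = \int[mu]_(z in `[0, 1]) x1).
      by rewrite Rintegral_itv_cst// subr0 mulr1 subrr.
    apply: eq_Rintegral => z; rewrite inE/= in_itv/= => z01.
    by rewrite max_l//; have /andP[] := pX.1 _ z01.
  by move=> ->; lra.
pose d : R := 4^-1.
have d0 : 0 < d by rewrite invr_gt0.
pose b0 := tail X 0 + d; pose b1 := tail X 0 + 2 + x1.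
(* Truncating b from below makes the function Lipschitz on the whole line. *)
pose cl b := Num.max b b0.
have b0cl b : b0 <= cl b by rewrite le_max lexx orbT.
have tcl b : tail X 0 < cl b by rewrite (lt_le_trans _ (b0cl b))// ltrDl.
have icl b : mu.-integrable `[0, x1] (EFin \o (fun x => (cl b - tail X x)^-1 ^+ 2)).
  exact: integrable_inv_tail.
pose L := (d ^+ 2)^-1 + 2 * d^-1 ^+ 3 * x1.
have cstat : continuous (fun b => stationarity X (cl b)).
  apply: (@nondecreasing_lip_continuous R L) => x y xy.
  have clxy : cl x <= cl y by rewrite /cl ge_max !le_max xy lexx orbT.
  have clD : cl y - cl x <= y - x.
    by rewrite /cl; case: (leP x b0); case: (leP y b0) => *; lra.
  have dcl : d <= cl x by rewrite (le_trans _ (b0cl x))// lerDr.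
  have /andP[e1 e2] := subr_inv_bound d0 dcl clxy.
  have -> : stationarity X (cl y) - stationarity X (cl x) = (cl x)^-1 - (cl y)^-1 +
     \int[mu]_(t in `[0, x1]) ((cl x - tail X t)^-1 ^+ 2 - (cl y - tail X t)^-1 ^+ 2).
    by rewrite RintegralB//; rewrite /stationarity; ring.
  have ptw t : 0 <= t <= x1 ->
      0 <= (cl x - tail X t)^-1 ^+ 2 - (cl y - tail X t)^-1 ^+ 2 <= 2 * d^-1 ^+ 3 * (cl y - cl x).
    move=> /andP[t0 _].
    have -> : cl y - cl x = (cl y - tail X t) - (cl x - tail X t) by ring.
    apply: subr_inv2_bound => //; last by rewrite lerD2r.
    have := b0cl x; rewrite /b0; have := tail_ni pX t0; lra.
  rewrite addr_ge0 ?e1//=; last by apply: Rintegral_itv_ge0 => t /ptw /andP[].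
  rewrite /L mulrDl lerD//.
    by rewrite (le_trans e2)// mulrC ler_wpM2l// invr_ge0 exprn_ge0// ltW.
  apply: (@le_trans _ _ (\int[mu]_(t in `[0, x1]) (2 * d^-1 ^+ 3 * (cl y - cl x)))).
    apply: le_Rintegral_itv.
    - exact: integrable_itvB.
    - exact: integrable_nondecreasing_itv.
    - by move=> t /ptw /andP[].
  rewrite Rintegral_itv_cst// subr0 mulrAC ler_wpM2l//.
  by rewrite !mulr_ge0// ?exprn_ge0// invr_ge0 ltW.
have b01 : b0 <= b1 by rewrite /b0 /b1 /d; lra.
have [|b bI] := @IVT _ _ _ _ 0 b01 (continuous_subspaceT cstat).
  have stat0 : stationarity X (cl b0) <= 0.
    have clb0 : cl b0 = b0 by rewrite /cl maxxx.
    have I0 : 0 <= \int[mu]_(x in `[0, x1]) (b0 - tail X x)^-1 ^+ 2.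
      by apply: Rintegral_itv_ge0 => x _; exact: sqr_ge0.
    have b0_gt0 : 0 < b0 by rewrite ltr_wpDl.
    rewrite /stationarity clb0; have [x1d|dx1] := leP x1 d.
      have : 2 <= b0^-1.
        by rewrite -[2]invrK lef_pV2 ?posrE ?invr_gt0// /b0; move: x1d; rewrite /d; lra.
      by move: I0; lra.
    have : 1 <= \int[mu]_(x in `[0, x1]) (b0 - tail X x)^-1 ^+ 2.
      apply: (@le_trans _ _ (\int[mu]_(x in `[0, d]) (b0 - tail X x)^-1 ^+ 2)); last first.
        have i0 := icl b0; rewrite clb0 in i0.
        have d0' := ltW d0; have dx1' := ltW dx1.
        rewrite -subr_ge0 Rintegral_itvB ?bnd_simp//.
        by apply: Rintegral_ge0 => x _; exact: sqr_ge0.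
      have -> : 1 = \int[mu]_(x in `[0, d]) 4 by rewrite Rintegral_itv_cst ?ltW// subr0 divff.
      apply: le_Rintegral_itv.
      - exact: integrable_nondecreasing_itv.
      - have i0 := icl b0; rewrite clb0 in i0; apply: integrableS i0 => //.
        by apply: subset_itvl; rewrite bnd_simp ltW.
      - move=> x /andP[x0 xd].
        have tx : 0 < b0 - tail X x by rewrite subr_gt0 -clb0 (le_lt_trans (tail_ni pX x0)).
        have -> : 4 = (2^-1)^-1 ^+ 2 :> R by field.
        rewrite lerXn2r ?nnegrE ?invr_ge0 ?(ltW tx)//.
        rewrite lef_pV2 ?posrE//.
        have /andP[_] := tail_lip pX x0; rewrite /b0 subr0.
        by move: xd; rewrite /d; lra.
    have : 0 < b0^-1 by rewrite invr_gt0.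
    lra.
  have stat1 : 0 <= stationarity X (cl b1).
    have -> : cl b1 = b1 by rewrite /cl max_l.
    have b1ge : 2 <= b1 by rewrite /b1; lra.
    have : b1^-1 <= 2^-1 by rewrite lef_pV2 ?posrE// (lt_le_trans _ b1ge).
    suff : \int[mu]_(x in `[0, x1]) (b1 - tail X x)^-1 ^+ 2 <= 2^-1 by rewrite /stationarity; lra.
    have y2 : 0 < 2 + x1 by rewrite ltr_wpDr.
    apply: (@le_trans _ _ (\int[mu]_(x in `[0, x1]) (2 + x1)^-1 ^+ 2)).
      apply: le_Rintegral_itv.
      - by apply: integrable_inv_tail => //; rewrite /b1; lra.
      - exact: integrable_nondecreasing_itv.
      - move=> x /andP[x0 _]; have := tail_ni pX x0 => tx.
        have ty : 2 + x1 <= b1 - tail X x by rewrite /b1; lra.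
        have t0 : 0 < b1 - tail X x by rewrite (lt_le_trans y2).
        by rewrite lerXn2r ?nnegrE ?invr_ge0 ?(ltW y2) ?(ltW t0)// lef_pV2.
    rewrite Rintegral_itv_cst// subr0 exprVn mulrC ler_pdivrMr ?exprn_gt0//.
    by nra.
  by rewrite ge_min stat0/= le_max stat1 orbT.
move=> Sb; exists (cl b); split => //.
by rewrite (lt_le_trans _ (b0cl b))// ltr_wpDl.
Qed.

Lemma ln_tangent (u v : R) : 0 < u -> 0 < v -> ln v <= ln u + (v - u) / u.
Proof.
move=> u0 v0.
have -> : v = u * (1 + (v - u) / u) by field; rewrite gt_eqF.
have e : 1 + (v - u) / u = v / u by field; rewrite gt_eqF.
rewrite lnM ?posrE// ?e ?divr_gt0// lerD2l.
rewrite [X in _ <= X](_ : _ = (v - u) / u); last by field; rewrite gt_eqF.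
by rewrite -e; apply: le_ln1Dx; rewrite -subr_gt0 opprK addrC e divr_gt0.
Qed.

Lemma inv_tangent (u v : R) : 0 < u -> 0 < v ->
  u^-1 - (v - u) * u^-1 ^+ 2 <= v^-1.
Proof.
move=> u0 v0; rewrite -subr_ge0.
have -> : v^-1 - (u^-1 - (v - u) * u^-1 ^+ 2) = (v - u) ^+ 2 / (v * u ^+ 2).
  by field; rewrite !gt_eqF.
by rewrite divr_ge0 ?sqr_ge0// mulr_ge0 ?sqr_ge0// ltW.
Qed.

(** Since [1 / u] and [- ln] are convex, [free_energy] lies above its tangent at
    the stationary point [b2] and the profile [X2], where the derivative in [b]
    vanishes.  The remaining derivative, in the direction [tail X1 - tail X2],
    becomes the integral of [G (X1 z) - G (X2 z)] after exchanging the integrals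
    over [x] and [z]. *)
Lemma free_energy_envelope (X2 : R -> R) : profile X2 ->
  exists (b2 : R) (G : R -> R),
  [/\ 0 < b2, tail X2 0 < b2,
   forall y y', y <= y' -> 0 <= G y' - G y <= y' - y &
   forall (X1 : R -> R) (b1 : R), profile X1 -> 0 < b1 -> tail X1 0 < b1 ->
     free_energy X2 b2 <= free_energy X1 b1 +
       \int[mu]_(z in `[0, 1]) (G (X1 z) - G (X2 z))].
Proof.
move=> pX2; have [b2 [b20 tb2]] := exists_stationary pX2.
rewrite /stationarity => st.
pose w x := (b2 - tail X2 x)^-1 ^+ 2.
have w0 x : 0 <= w x by exact: sqr_ge0.
have iw : mu.-integrable `[0, x1] (EFin \o w) by exact: integrable_inv_tail.
have w_ni x y : 0 <= x -> x <= y -> w y <= w x.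
  move=> x0 xy; rewrite lerXn2r ?nnegrE ?invr_ge0 ?(ltW (subr_tail_gt0 _ _ _))// ?(le_trans x0)//.
  exact: inv_tail_ni.
have mw : measurable_fun `[0, x1] w.
  by have /measurable_int/measurable_EFinP := iw.
pose G y := \int[mu]_(x in `[0, x1]) (w x * Num.max x y).
have iwG (f : R -> R) : (forall x y, 0 <= x -> x <= y -> y <= x1 -> f x <= f y) ->
    mu.-integrable `[0, x1] (EFin \o (fun x => w x * f x)).
  move=> fnd; apply: (@integrable_itv_bounded _ _ _ (w 0 * (`|f 0| + `|f x1|))).
    by apply: measurable_funM => //; exact: measurable_nondecreasing_itv.
  move=> x /andP[x0 xx1]; rewrite normrM ger0_norm// ler_pM//; first exact: w_ni.
  have := fnd _ _ (lexx 0) x0 xx1; have := fnd _ _ x0 xx1 (lexx _).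
  have := ler_norm (f x1); have := ler_norm (- f 0); rewrite normrN.
  have := normr_ge0 (f 0); have := normr_ge0 (f x1).
  rewrite ler_norml; lra.
have imax y : mu.-integrable `[0, x1] (EFin \o (fun x => w x * Num.max x y)).
  by apply: iwG => u v _ uv _; rewrite ge_max !le_max uv lexx orbT.
have Glip y y' : y <= y' -> 0 <= G y' - G y <= y' - y.
  move=> yy'.
  have -> : G y' - G y = \int[mu]_(x in `[0, x1]) (w x * Num.max x y' - w x * Num.max x y).
    by rewrite RintegralB.
  have ptw x : 0 <= w x * Num.max x y' - w x * Num.max x y <= (y' - y) * w x.
    rewrite -mulrBr mulr_ge0//=.
      by rewrite mulrC ler_wpM2r//; case: (leP x y'); case: (leP x y) => *; lra.
    by case: (leP x y'); case: (leP x y) => *; lra.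
  apply/andP; split; first by apply: Rintegral_itv_ge0 => x _; have /andP[] := ptw x.
  apply: (@le_trans _ _ (\int[mu]_(x in `[0, x1]) ((y' - y) * w x))).
    apply: le_Rintegral_itv.
    - exact: integrable_itvB.
    - exact: integrable_itvZ.
    - by move=> x _; have /andP[] := ptw x.
  rewrite RintegralZl// ler_piMr ?subr_ge0//.
  have : 0 < b2^-1 by rewrite invr_gt0.
  by move: st; rewrite -/w; lra.
have Gnd y y' : y <= y' -> G y <= G y'.
  by move=> /Glip /andP[]; rewrite subr_ge0.
have iG X : profile X -> mu.-integrable `[0, 1] (EFin \o (fun z => G (X z))).
  move=> pX; apply: integrable_nondecreasing_itv => z z' z0 zz' z1.
  exact/Gnd/pX.2.
have itail X : profile X -> mu.-integrable `[0, x1] (EFin \o (fun x => w x * tail X x)).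
  move=> pX.
  have : mu.-integrable `[0, x1] (EFin \o (fun x => (-1) * (w x * - tail X x))).
    by apply: integrable_itvZ; apply: iwG => x y _ xy _; rewrite lerN2 tail_ni.
  by apply: eq_integrable => // x _ /=; congr (_%:E); ring.
have wtail X : profile X -> \int[mu]_(x in `[0, x1]) (w x * tail X x) =
    x1 * \int[mu]_(x in `[0, x1]) w x - \int[mu]_(z in `[0, 1]) G (X z).
  move=> pX; rewrite /G -Rintegral_fubini.
  - have iM x : \int[mu]_(y in `[0, 1]) (w x * Num.max x (X y)) =
        w x * \int[mu]_(y in `[0, 1]) Num.max x (X y).
      by rewrite RintegralZl//; exact: integrable_max.
    under [X in _ - X]eq_Rintegral do rewrite iM.
    have iM2 : mu.-integrable `[0, x1]
        (EFin \o (fun x => w x * \int[mu]_(y in `[0, 1]) Num.max x (X y))).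
      apply: iwG => x y _ xy _.
      by have := tail_ni pX xy; rewrite /tail lerD2l lerN2.
    have iZ := integrable_itvZ x1 iw.
    rewrite -RintegralZl// -RintegralB//.
    by apply: eq_Rintegral => x _; rewrite /tail; ring.
  - have mfst : measurable_fun (`[0, x1]%classic `*` `[0, 1]%classic : set (R * R)) fst.
      exact: measurable_funTS.
    apply: measurable_funM; first exact: (measurable_setX_fst _ _ mw).
    apply: measurable_maxr => //; apply: measurable_setX_snd => //.
    by apply: measurable_nondecreasing_itv; exact: pX.2.
  - move=> x z /andP[x0 _] _; rewrite mulr_ge0// le_max x0//.
  - by move=> x _; apply: integrable_itvZ; exact: integrable_max.
  - by move=> z _; exact: imax.
exists b2, G; split => // X1 b1 pX1 b10 tb1.
have I1 : mu.-integrable `[0, x1] (EFin \o (fun x => (b1 - tail X1 x)^-1)).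
  by have := integrable_inv_tail pX1 tb1 1; apply: eq_integrable => // x _ /=; rewrite expr1.
have I2 : mu.-integrable `[0, x1] (EFin \o (fun x => (b2 - tail X2 x)^-1)).
  by have := integrable_inv_tail pX2 tb2 1; apply: eq_integrable => // x _ /=; rewrite expr1.
have Iconv : \int[mu]_(x in `[0, x1]) (b2 - tail X2 x)^-1 -
    (b1 - b2) * \int[mu]_(x in `[0, x1]) w x +
    (\int[mu]_(x in `[0, x1]) (w x * tail X1 x) - \int[mu]_(x in `[0, x1]) (w x * tail X2 x)) <=
    \int[mu]_(x in `[0, x1]) (b1 - tail X1 x)^-1.
  have iZ := integrable_itvZ (b1 - b2) iw.
  have it1 := itail _ pX1; have it2 := itail _ pX2.
  rewrite -RintegralZl// -RintegralB// -RintegralB//.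
  have iA := integrable_itvB I2 iZ; have iB := integrable_itvB it1 it2.
  rewrite -RintegralD//; apply: le_Rintegral_itv => //.
  - exact: integrable_itvD.
  - move=> x /andP[x0 _].
    apply: le_trans (inv_tangent (subr_tail_gt0 pX2 tb2 x0) (subr_tail_gt0 pX1 tb1 x0)).
    by rewrite -/(w x) le_eqVlt; apply/orP; left; apply/eqP; ring.
have lnc := ln_tangent b20 b10.
have iG1 := iG _ pX1; have iG2 := iG _ pX2.
rewrite RintegralB//.
move: Iconv; rewrite !wtail// => Iconv.
rewrite /free_energy.
have key : (b1 - b2) * (1 - b2^-1 - \int[mu]_(x in `[0, x1]) w x) = 0.
  by rewrite st mulr0.
have : (b1 - b2) / b2 = (b1 - b2) * b2^-1 by [].
move: lnc Iconv key.
move: (\int[mu]_(x in _) _) (\int[mu]_(x in _) _) (\int[mu]_(x in _) _) => J1 J2 J3.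
move: (\int[mu]_(x in _) _) (\int[mu]_(x in _) _) => J4 J5.
lra.
Qed.
End envelope.

(** * Polynomials with nonnegative coefficients *)

Section posexpr.
Context (R : realType) (S : finType).

(** The remainder of a product is
    [a * rb + ra * bh + h * a' * rb + h ^+ 2 * (a' * b')], and the same identity
    holds for the majorants; the bound is then term by term. *)
Lemma taylor_mul (a b a' b' ah bh A0 B0 A1 B1 AH BH h eta : R) :
  `|a| <= A0 -> `|a'| <= A1 -> `|b'| <= B1 -> `|bh| <= BH -> `|h| <= eta ->
  eta ^+ 2 * `|ah - a - h * a'| <= h ^+ 2 * (AH - A0 - eta * A1) ->
  eta ^+ 2 * `|bh - b - h * b'| <= h ^+ 2 * (BH - B0 - eta * B1) ->
  eta ^+ 2 * `|ah * bh - a * b - h * (a' * b + a * b')| <=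
  h ^+ 2 * (AH * BH - A0 * B0 - eta * (A1 * B0 + A0 * B1)).
Proof.
move=> aA a'A b'B bB heta.
set ra := ah - a - _; set rb := bh - b - _.
set RA := AH - _ - _; set RB := BH - _ - _ => hra hrb.
have eta0 : 0 <= eta by exact: le_trans heta.
have -> : ah * bh - a * b - h * (a' * b + a * b') =
    a * rb + ra * bh + h * a' * rb + h ^+ 2 * (a' * b').
  by rewrite /ra /rb; ring.
have -> : h ^+ 2 * (AH * BH - A0 * B0 - eta * (A1 * B0 + A0 * B1)) =
    A0 * (h ^+ 2 * RB) + (h ^+ 2 * RA) * BH + (eta * A1) * (h ^+ 2 * RB) +
    h ^+ 2 * (eta ^+ 2 * (A1 * B1)).
  by rewrite /RA /RB; ring.
have t1 : eta ^+ 2 * `|a * rb| <= A0 * (h ^+ 2 * RB).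
  by rewrite normrM mulrCA ler_pM// mulr_ge0// sqr_ge0.
have t2 : eta ^+ 2 * `|ra * bh| <= (h ^+ 2 * RA) * BH.
  by rewrite normrM mulrA ler_pM// mulr_ge0// sqr_ge0.
have t3 : eta ^+ 2 * `|h * a' * rb| <= (eta * A1) * (h ^+ 2 * RB).
  have ha' : `|h * a'| <= eta * A1 by rewrite normrM ler_pM.
  by rewrite normrM mulrCA ler_pM// mulr_ge0// sqr_ge0.
have t4 : eta ^+ 2 * `|h ^+ 2 * (a' * b')| <= h ^+ 2 * (eta ^+ 2 * (A1 * B1)).
  rewrite normrM (ger0_norm (sqr_ge0 h)) mulrCA ler_wpM2l ?sqr_ge0//.
  by rewrite ler_wpM2l ?sqr_ge0// normrM ler_pM.
apply: le_trans (ler_wpM2l (sqr_ge0 _) (ler_normD _ _)) _.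
rewrite mulrDr lerD//.
apply: le_trans (ler_wpM2l (sqr_ge0 _) (ler_normD _ _)) _.
rewrite mulrDr lerD//.
apply: le_trans (ler_wpM2l (sqr_ge0 _) (ler_normD _ _)) _.
by rewrite mulrDr lerD.
Qed.

Lemma convex_mul (a a' b b' A1 B1 A2 B2 : R) :
  0 <= a -> a <= a' -> 0 <= b -> b <= b' ->
  A1 <= a' - a <= B1 -> A2 <= b' - b <= B2 ->
  b * A1 + a * A2 <= a' * b' - a * b <= b' * B1 + a' * B2.
Proof.
move=> a0 aa b0 bb /andP[l1 u1] /andP[l2 u2].
have -> : a' * b' - a * b = (a' - a) * b' + a * (b' - b) by ring.
have a'0 := le_trans a0 aa; have b'0 := le_trans b0 bb.
have da : 0 <= a' - a by rewrite subr_ge0.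
have db : 0 <= b' - b by rewrite subr_ge0.
apply/andP; split; apply: lerD.
- by apply: le_trans (ler_wpM2l b0 l1) _; rewrite mulrC ler_wpM2l.
- exact: ler_wpM2l.
- by rewrite mulrC ler_wpM2l.
- by apply: le_trans (ler_wpM2r db aa) _; rewrite ler_wpM2l.
Qed.

(** Syntax of multivariate polynomials with nonnegative coefficients.  The syntax
    makes differentiation a recursive function whose values are again of this
    kind, so that it can be iterated. *)
Inductive posexpr :=
  | PCst of {nonneg R}
  | PVar of S
  | PAdd of posexpr & posexpr
  | PMul of posexpr & posexpr.

Fixpoint ev (e : posexpr) (q : S -> R) : R :=
  match e with
  | PCst c => c%:num
  | PVar s => q s
  | PAdd e1 e2 => ev e1 q + ev e2 q
  | PMul e1 e2 => ev e1 q * ev e2 q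
  end.

Fixpoint dv (s : S) (e : posexpr) : posexpr :=
  match e with
  | PCst _ => PCst 0%:nng
  | PVar s' => PCst ((s' == s)%:R)%:nng
  | PAdd e1 e2 => PAdd (dv s e1) (dv s e2)
  | PMul e1 e2 => PAdd (PMul (dv s e1) e2) (PMul e1 (dv s e2))
  end.

Definition upd (q : S -> R) s t := fun s' => if s' == s then t else q s'.

Lemma ev_ge0 e q : (forall s, 0 <= q s) -> 0 <= ev e q.
Proof.
by move=> q0; elim: e => //= [e1 h1 e2 h2|e1 h1 e2 h2]; rewrite ?addr_ge0 ?mulr_ge0.
Qed.

Lemma ev_norm e q r : (forall s, `|q s| <= r s) -> `|ev e q| <= ev e r.
Proof.
move=> qr; elim: e => //= [c|e1 h1 e2 h2|e1 h1 e2 h2].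
- by rewrite ger0_norm.
- by rewrite (le_trans (ler_normD _ _))// lerD.
- by rewrite normrM ler_pM.
Qed.

Lemma ev_mono e q r : (forall s, 0 <= q s <= r s) -> ev e q <= ev e r.
Proof.
move=> qr; apply: le_trans (ler_norm _) _; apply: ev_norm => s.
by have /andP[q0] := qr s; rewrite ger0_norm.
Qed.

(** The Taylor coefficients of order at least 2 at [q] are dominated by those at
    [r], and [h ^+ k * eta ^+ 2 <= eta ^+ k * h ^+ 2] in absolute value for
    [2 <= k]: the remainder at [q] for the increment [h] is controlled by the one
    at [r] for [eta], without counting degrees. *)
Lemma ev_taylor e s q r h eta : (forall s', `|q s'| <= r s') -> `|h| <= eta ->
  eta ^+ 2 * `|ev e (upd q s (q s + h)) - ev e q - h * ev (dv s e) q| <=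
  h ^+ 2 * (ev e (upd r s (r s + eta)) - ev e r - eta * ev (dv s e) r).
Proof.
move=> qr heta.
have eta0 : 0 <= eta by exact: le_trans heta.
elim: e => /= [c|s'|e1 h1 e2 h2|e1 h1 e2 h2].
- by rewrite !mulr0 !subr0 !subrr normr0 !mulr0.
- rewrite /upd; case: eqP => [->|_] /=; rewrite ?mulr1 ?mulr0.
    rewrite (_ : q s + h - q s - h = 0) ?normr0 ?mulr0; last by ring.
    by rewrite (_ : r s + eta - r s - eta = 0) ?mulr0; last by ring.
  by rewrite !subrr normr0 !mulr0.
- rewrite (_ : _ - _ - _ = (ev e1 (upd q s (q s + h)) - ev e1 q - h * ev (dv s e1) q) +
      (ev e2 (upd q s (q s + h)) - ev e2 q - h * ev (dv s e2) q)); last by ring.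
  apply: le_trans (ler_wpM2l (sqr_ge0 _) (ler_normD _ _)) _.
  rewrite mulrDr; apply: le_trans (lerD h1 h2) _.
  by rewrite le_eqVlt; apply/orP; left; apply/eqP; ring.
- apply: taylor_mul => //; apply: ev_norm => // s'.
  rewrite /upd; case: eqP => // _.
  by rewrite (le_trans (ler_normD _ _))// lerD.
Qed.

(** Along a segment with nonnegative direction, the polynomial is convex because
    its second derivatives are nonnegative. *)
Lemma ev_convex e q q' : (forall s, 0 <= q s <= q' s) ->
  \sum_s ev (dv s e) q * (q' s - q s) <= ev e q' - ev e q <=
  \sum_s ev (dv s e) q' * (q' s - q s).
Proof.
move=> qq'.
have q0 s : 0 <= q s by have /andP[] := qq' s.
have q'0 s : 0 <= q' s by have /andP[/le_trans] := qq' s; apply.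
have D s : 0 <= q' s - q s by rewrite subr_ge0; have /andP[] := qq' s.
elim: e => /= [c|s'|e1 h1 e2 h2|e1 h1 e2 h2].
- by rewrite !big1 ?subrr ?lexx// => s _; rewrite mul0r.
- rewrite (bigD1 s')//= eqxx mul1r big1 ?addr0 ?lexx//.
  by move=> s /negbTE ss; rewrite eq_sym ss mul0r.
- under eq_bigr do rewrite mulrDl; rewrite big_split/=.
  under [X in _ <= _ <= X]eq_bigr do rewrite mulrDl; rewrite big_split/=.
  lra.
- under eq_bigr do rewrite mulrDl; rewrite big_split/=.
  under [X in _ <= _ <= X]eq_bigr do rewrite mulrDl; rewrite big_split/=.
  have X u v (x : S -> R) : \sum_s u s * v * x s = v * \sum_s u s * x s.
    by rewrite mulr_sumr; apply: eq_bigr => s _; ring.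
  have Y u v (x : S -> R) : \sum_s u * v s * x s = u * \sum_s v s * x s.
    by rewrite mulr_sumr; apply: eq_bigr => s _; ring.
  rewrite !X !Y.
  by apply: convex_mul => //; [exact: ev_ge0|exact: ev_mono|exact: ev_ge0|exact: ev_mono].
Qed.

End posexpr.

(** * Series of polynomials with nonnegative coefficients *)

Section has_sum.
Context (R : realType).

(** Convergence and value in one predicate, so that sums of linear combinations
    compose without side conditions. *)
Definition has_sum (u : nat -> R) (l : R) := series u @ \oo --> l.

Lemma has_sumD u v a b : has_sum u a -> has_sum v b ->
  has_sum (fun n => u n + v n) (a + b).
Proof.
move=> ua vb; rewrite /has_sum (_ : series _ = series u + series v); first exact: cvgD.
by apply/funext => n; rewrite /series/= fctE big_split.
Qed.

Lemma has_sumZ k u a : has_sum u a -> has_sum (fun n => k * u n) (k * a).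
Proof.
move=> ua; rewrite /has_sum (_ : series _ = (fun n => k * series u n)); first exact: cvgMr.
by apply/funext => n; rewrite /series/= mulr_sumr.
Qed.

Arguments has_sumD {u v a b} _ _.
Arguments has_sumZ k {u a} _.

Lemma has_sumB u v a b : has_sum u a -> has_sum v b ->
  has_sum (fun n => u n - v n) (a - b).
Proof.
move=> ua vb; rewrite -[- b]mulN1r.
rewrite (_ : (fun n => _) = (fun n => u n + (-1) * v n)); last first.
  by apply/funext => n; rewrite mulN1r.
by apply: has_sumD => //; exact: has_sumZ.
Qed.

Lemma has_sum0 : has_sum (fun=> 0) 0.
Proof.
rewrite /has_sum (_ : series _ = fun=> 0); first exact: cvg_cst.
by apply/funext => n; rewrite /series/= big1.
Qed.

Arguments has_sumB {u v a b} _ _.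
Arguments has_sum0 : clear implicits.

Lemma has_sum_sum (I : Type) (r : seq I) (u : I -> nat -> R) a :
  (forall i, has_sum (u i) (a i)) ->
  has_sum (fun n => \sum_(i <- r) u i n) (\sum_(i <- r) a i).
Proof.
move=> ua; elim: r => [|i r ih].
  rewrite big_nil (_ : (fun n => _) = (fun=> 0)); first exact: has_sum0.
  by apply/funext => n; rewrite big_nil.
rewrite big_cons (_ : (fun n => _) = (fun n => u i n + \sum_(j <- r) u j n)).
  exact: has_sumD.
by apply/funext => n; rewrite big_cons.
Qed.

Arguments has_sum_sum {I r u a} _.

Lemma has_sum_le u v a b : has_sum u a -> has_sum v b ->
  (forall n, u n <= v n) -> a <= b.
Proof.
move=> ua vb uv; apply: (ler_cvg_to ua vb); apply: nearW => n.
exact: ler_sum.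
Qed.

Lemma has_sum_ge0 u a : has_sum u a -> (forall n, 0 <= u n) -> 0 <= a.
Proof. by move=> ua; exact: has_sum_le has_sum0 ua. Qed.

Lemma has_sum_norm u v a b : has_sum u a -> has_sum v b ->
  (forall n, `|u n| <= v n) -> `|a| <= b.
Proof.
move=> ua vb uv; rewrite ler_norml -[- b]sub0r; apply/andP; split.
  apply: (has_sum_le (has_sumB has_sum0 vb) ua) => n.
  by have := uv n; rewrite ler_norml sub0r => /andP[].
by apply: (has_sum_le ua vb) => n; exact: le_trans (ler_norm _) (uv n).
Qed.

Lemma has_sum_dominated u v b : has_sum v b -> (forall n, `|u n| <= v n) ->
  exists a, has_sum u a.
Proof.
move=> vb uv; exists (limn (series u)).
apply: normed_cvg; apply: (series_le_cvg _ _ uv) => // [n|].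
  exact: le_trans (uv n).
by apply/cvg_ex; exists b.
Qed.

End has_sum.
Arguments has_sum0 {R}.
Arguments has_sumD {R u v a b} _ _.
Arguments has_sumB {R u v a b} _ _.
Arguments has_sumZ {R} k {u a} _.
Arguments has_sum_sum {R I r u a} _.

Lemma is_derive_quadratic (R : realType) (f : R -> R) (x l K eta : R) : 0 < eta ->
  (forall h, `|h| <= eta -> `|f (x + h) - f x - h * l| <= K * h ^+ 2) ->
  is_derive x (1 : R) f l.
Proof.
move=> eta0 fK.
have lim : (fun h => h^-1 *: (f (h *: (1 : R) + x) - f x)) @ 0^' --> l.
  apply/cvgrPdist_le => /= e e0.
  have K0 : 0 < `|K| + 1 by rewrite ltr_wpDl.
  near=> h.
  have h0 : h != 0 by near: h; exact: nbhs_dnbhs_neq.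
  have heta : `|h| <= eta.
    near: h; apply: dnbhs0_le => //.
  have he : `|h| <= e / (`|K| + 1).
    by near: h; apply: dnbhs0_le; rewrite divr_gt0.
  have -> : l - h^-1 *: (f (h *: (1 : R) + x) - f x) =
      - (h^-1 * (f (x + h) - f x - h * l)).
    rewrite /GRing.scale/= mulr1 (addrC h x); field; exact: h0.
  rewrite normrN normrM normfV ler_pdivrMl ?normr_gt0//.
  apply: le_trans (fK _ heta) _.
  rewrite -real_normK ?num_real// expr2 mulrCA ler_wpM2l//.
  apply: (@le_trans _ _ ((`|K| + 1) * `|h|)).
    by rewrite ler_wpM2r// (le_trans (ler_norm _))// lerDl.
  by rewrite mulrC -ler_pdivlMr.
split; first by apply/cvg_ex; exists l.
by rewrite /derive; apply/cvg_lim.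
Unshelve. all: end_near. Qed.

Section psum.
Context (R : realType) (S : finType).
Implicit Types (e : nat -> posexpr R S) (q : S -> R).

(** Summability at the constant point [r] controls the series on the whole cube of
    points with coordinates bounded by [r]. *)
Definition summable_at (r : R) e := exists l, has_sum (fun n => ev (e n) (fun=> r)) l.

Definition psum e q : R := limn (series (fun n => ev (e n) q)).

Definition deriv_series s e : nat -> posexpr R S := fun n => dv s (e n).

Lemma psumP (r : R) e q : summable_at r e -> (forall s, `|q s| <= r) ->
  has_sum (fun n => ev (e n) q) (psum e q).
Proof.
move=> [l hl] qr.
have [a ha] : exists a, has_sum (fun n => ev (e n) q) a.
  by apply: (has_sum_dominated hl) => n; exact: ev_norm.
by rewrite /psum (cvg_lim _ ha).
Qed.

(** Convexity gives [(r - r') * dv s e <= e(r)], the left side being taken at the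
    constant point [r']: differentiating only costs a smaller radius. *)
Lemma summable_deriv_series (r r' : R) s e :
  0 <= r' -> r' < r -> summable_at r e -> summable_at r' (deriv_series s e).
Proof.
move=> r0 rr' [l hl]; rewrite /summable_at /deriv_series.
apply: (has_sum_dominated (has_sumZ (r - r')^-1 hl)) => n.
have d0 : 0 < r - r' by rewrite subr_gt0.
rewrite ger0_norm ?ev_ge0// ler_pdivlMl//.
have q'E s' : 0 <= r' <= upd (fun=> r') s r s'.
  by rewrite /upd r0; case: ifP => //= _; exact: ltW.
have /andP[+ _] := ev_convex (e n) q'E.
have us : upd (fun=> r') s r s = r by rewrite /upd eqxx.
rewrite (bigD1 s)//= us big1 ?addr0; last first.
  by move=> s' /negbTE; rewrite /upd => ->; rewrite subrr mulr0.
rewrite mulrC => /le_trans; apply; rewrite lerBlDr ler_wpDr ?ev_ge0//.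
apply: ev_mono => s'; rewrite /upd; case: ifP => _.
  by rewrite lexx (le_trans r0)// ltW.
by rewrite r0 ltW.
Qed.

(** Summing [ev_taylor] with [eta = r - r'] bounds the Taylor remainder of the
    whole series by a constant times [h ^+ 2].  The function [f] only has to agree
    with a multiple of the series on the cube of radius [r], so that the result
    applies again to the partial derivatives it produces. *)
Lemma is_derive_psum (r r' : R) e c f s q : 0 <= r' -> r' < r -> summable_at r e ->
  (forall q, (forall s, `|q s| <= r) -> f q = c * psum e q) ->
  (forall s, `|q s| <= r') ->
  is_derive (q s) (1 : R) (fun t => f (upd q s t)) (c * psum (deriv_series s e) q).
Proof.
move=> r0 rr' sr fE qr'.
pose eta := r - r'.
have eta0 : 0 < eta by rewrite subr_gt0.
have qr s' : `|q s'| <= r by exact: le_trans (qr' _) (ltW rr').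
have updr h : `|h| <= eta -> forall s', `|upd q s (q s + h) s'| <= r.
  move=> hh s'; rewrite /upd; case: ifP => // _.
  by rewrite (le_trans (ler_normD _ _))// -(subrKC r' r) lerD.
apply: (@is_derive_quadratic _ _ _ _ (`|c| * (psum e (fun=> r) / eta ^+ 2)) eta eta0) => h hh.
have -> : upd q s (q s) = q.
  by apply/funext => s'; rewrite /upd; case: eqP => // ->.
rewrite !fE//; last exact: updr.
rewrite (_ : _ - _ - _ = c * (psum e (upd q s (q s + h)) - psum e q -
  h * psum (deriv_series s e) q)); last by ring.
rewrite normrM -mulrA ler_wpM2l//.
rewrite [leRHS](_ : _ = (eta ^+ 2)^-1 * (h ^+ 2 * psum e (fun=> r))); last by ring.
have h1 := psumP sr (updr _ hh); have h2 := psumP sr qr.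
have h3 := psumP (summable_deriv_series s r0 rr' sr) qr'.
have h4 : has_sum (fun n => ev (e n) (fun=> r)) (psum e (fun=> r)).
  by apply: psumP sr _ => _; rewrite ger0_norm// (le_trans r0)// ltW.
apply: (has_sum_norm (has_sumB (has_sumB h1 h2) (has_sumZ h h3))
  (has_sumZ (eta ^+ 2)^-1 (has_sumZ (h ^+ 2) h4))).
move=> n /=; rewrite ler_pdivlMl ?exprn_gt0//.
apply: le_trans (ev_taylor (e n) s qr' hh) _.
rewrite ler_wpM2l ?sqr_ge0//.
have ge1 : 0 <= ev (e n) (fun=> r') by exact: ev_ge0.
have ge2 : 0 <= ev (dv s (e n)) (fun=> r') by exact: ev_ge0.
have : ev (e n) (upd (fun=> r') s (r' + eta)) <= ev (e n) (fun=> r).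
  apply: ev_mono => s'; rewrite /upd /eta subrKC; case: ifP => _.
    by rewrite lexx (le_trans r0)// ltW.
  by rewrite r0 ltW.
have : 0 <= eta * ev (dv s (e n)) (fun=> r') by rewrite mulr_ge0// ltW.
lra.
Qed.

Lemma partial_psum (r r' : R) e c f s q : 0 <= r' -> r' < r -> summable_at r e ->
  (forall q, (forall s, `|q s| <= r) -> f q = c * psum e q) ->
  (forall s, `|q s| <= r') ->
  partial f s q = c * psum (deriv_series s e) q.
Proof.
move=> r0 rr' sr fE qr'; rewrite /partial derive1E.
by have [_] := is_derive_psum s r0 rr' sr fE qr'.
Qed.

Lemma psum_ge0 (r : R) e q : summable_at r e -> (forall s, 0 <= q s <= r) -> 0 <= psum e q.
Proof.
move=> sr qr; apply: (has_sum_ge0 (psumP sr _)).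
  by move=> s; have /andP[q0 q1] := qr s; rewrite ger0_norm.
by move=> n; apply: ev_ge0 => s; have /andP[] := qr s.
Qed.

Lemma psum_mono (r : R) e q q' : summable_at r e -> (forall s, 0 <= q s <= q' s) ->
  (forall s, q' s <= r) -> psum e q <= psum e q'.
Proof.
move=> sr qq' qr; apply: (has_sum_le (psumP sr _) (psumP sr _)).
- move=> s; have /andP[q0 q1] := qq' s; rewrite ger0_norm// (le_trans q1)//.
- move=> s; have /andP[q0 q1] := qq' s; rewrite ger0_norm// (le_trans q0)//.
- by move=> n; exact: ev_mono.
Qed.

Lemma psum_convex (r r' : R) e q q' : r' < r -> summable_at r e ->
  (forall s, 0 <= q s <= q' s) -> (forall s, q' s <= r') -> 0 <= r' ->
  \sum_s psum (deriv_series s e) q * (q' s - q s) <= psum e q' - psum e q <=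
  \sum_s psum (deriv_series s e) q' * (q' s - q s).
Proof.
move=> rr' sr qq' qr' r0.
have q'n s : `|q' s| <= r'.
  by have /andP[q0 q1] := qq' s; rewrite ger0_norm// (le_trans q0).
have qn s : `|q s| <= r'.
  by have /andP[q0 q1] := qq' s; rewrite ger0_norm// (le_trans q1).
have nr (x : S -> R) : (forall s, `|x s| <= r') -> forall s, `|x s| <= r.
  by move=> xr s; rewrite (le_trans (xr s))// ltW.
have hd := has_sumB (psumP sr (nr _ q'n)) (psumP sr (nr _ qn)).
have hs (x : S -> R) : (forall s, `|x s| <= r') ->
    has_sum (fun n => \sum_s (q' s - q s) * ev (dv s (e n)) x)
      (\sum_s (q' s - q s) * psum (deriv_series s e) x).
  move=> xr; apply: has_sum_sum => s; apply: has_sumZ.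
  exact: psumP (summable_deriv_series s r0 rr' sr) xr.
under eq_bigr do rewrite mulrC.
under [X in _ <= _ <= X]eq_bigr do rewrite mulrC.
apply/andP; split.
  apply: (has_sum_le (hs _ qn) hd) => n.
  by under eq_bigr do rewrite mulrC; have /andP[] := ev_convex (e n) qq'.
apply: (has_sum_le hd (hs _ q'n)) => n.
by under eq_bigr do rewrite mulrC; have /andP[] := ev_convex (e n) qq'.
Qed.

End psum.

(** * The covariance function *)

Section representable.
Context (R : realType) (S : finType).

Definition representable (f : (S -> R) -> R) := exists e : posexpr R S, forall q, ev e q = f q.

Lemma representable_cst (c : R) : 0 <= c -> representable (fun=> c).
Proof. by move=> c0; exists (PCst _ (NngNum c0)). Qed.

Lemma representable_mul f g : representable f -> representable g ->
  representable (fun q => f q * g q).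
Proof. by move=> [e1 h1] [e2 h2]; exists (PMul e1 e2) => q /=; rewrite h1 h2. Qed.

Lemma representable_prod (t : seq S) : representable (fun q => \prod_(s <- t) q s).
Proof.
elim: t => [|s t [e he]].
  by exists (PCst _ 1%:nng) => q; rewrite big_nil.
by exists (PMul (PVar _ s) e) => q /=; rewrite big_cons he.
Qed.

Lemma representable_sum (I : Type) (r : seq I) (f : I -> (S -> R) -> R) :
  (forall i, representable (f i)) -> representable (fun q => \sum_(i <- r) f i q).
Proof.
move=> hf; elim: r => [|i r [e he]].
  by exists (PCst _ 0%:nng) => q; rewrite big_nil.
by have [e' he'] := hf i; exists (PAdd e' e) => q /=; rewrite big_cons he he'.
Qed.

End representable.

Section covariance.
Context (R : realType) (S : finType).
Variables (lambda : S -> R) (beta : nat -> R) (Delta2 : forall p : nat, p.-tuple S -> R).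
Arguments Delta2 : clear implicits.
Hypothesis lambda01 : forall s, 0 < lambda s <= 1.
Hypothesis Delta2_ge0 : forall (p : nat) (t : p.-tuple S), (1 <= p)%N -> 0 <= Delta2 p t.
Hypothesis decay : decay_condition lambda beta Delta2.

Local Notation xi := (xi lambda beta Delta2).
Local Notation xi_s := (xi_s lambda beta Delta2).
Local Notation theta := (theta lambda beta Delta2).
Local Notation C_star := (C_star lambda beta Delta2).

Lemma xi_psum : exists (r : R) (e : nat -> posexpr R S),
  [/\ 1 < r, summable_at r e & forall q, xi q = psum e q].
Proof.
have [eps eps0 dec] := decay.
pose u p q := beta p ^+ 2 * array_sum Delta2 p lambda q.
(* xi starts at p = 1; index 0 of the series is filled with 0. *)
have rep p : representable (fun q => if p == 0%N then 0 else u p q).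
  case: p => [|p] /=; first exact: representable_cst.
  apply: representable_mul; first exact/representable_cst/sqr_ge0.
  apply: representable_sum => t; apply: representable_mul.
    apply/representable_cst/mulr_ge0; first exact: Delta2_ge0.
    by apply: prodr_ge0 => s _; have /andP[/ltW] := lambda01 s.
  exact: representable_prod.
have [e he] := choice rep.
have sumE q n : \sum_(1 <= p < n) u p q = series (fun p => ev (e p) q) n.
  rewrite /series/=; case: n => [|n]; first by rewrite !big_geq.
  rewrite [RHS]big_ltn// he eqxx add0r.
  rewrite big_nat [RHS]big_nat; apply: eq_bigr => p /andP[p0 _].
  by rewrite he; case: p p0.
exists (1 + eps), e; split; first by rewrite ltrDl.
- suff : cvgn (series (fun p => ev (e p) (fun=> 1 + eps))).
    by move=> /cvg_ex[l hl]; exists l.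
  have ev0 p : 0 <= ev (e p) (fun=> 1 + eps).
    by apply: ev_ge0 => _; rewrite addr_ge0// ltW.
  apply: nondecreasing_is_cvgn.
    by move=> m n mn; rewrite -subr_ge0 sub_series_geq// sumr_ge0.
  pose v p := beta p ^+ 2 * (1 + eps) ^+ p * array_sum Delta2 p lambda (fun=> 1).
  have uv p : u p (fun=> 1 + eps) = v p.
    rewrite /u /v -mulrA; congr (_ * _); rewrite /array_sum mulr_sumr.
    apply: eq_bigr => t _; rewrite [RHS]mulrCA; congr (_ * _).
    by rewrite big_const_seq count_predT size_tuple iter_mulr_1 big1_eq mulr1.
  have v0 p : (1 <= p)%N -> 0 <= v p.
    by case: p => // p _; rewrite -uv; have := ev0 p.+1; rewrite he.
  exists (fine (\sum_(1 <= p <oo) (v p)%:E)%E) => _ [n _ <-].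
  rewrite -sumE -lee_fin fineK; last first.
    rewrite ge0_fin_numE//; apply: nneseries_ge0 => p p1 _; rewrite lee_fin.
    exact: v0.
  under eq_bigr do rewrite uv.
  rewrite -sumEFin; apply: nneseries_lim_ge => p p1 _; rewrite lee_fin; exact: v0.
- move=> q; rewrite /xi /psum; congr (lim _).
  by rewrite (_ : series _ = (fun n => \sum_(1 <= p < n) u p q))//; apply/funext => n; rewrite -sumE.
Qed.

(** Both estimates are convexity along nonnegative directions.  For [xi_s], the
    slope is bounded by the gradient at the far end [q'], hence by the one at 1.
    For [theta = q . grad xi - xi], the increment is at least
    [q . (grad xi q' - grad xi q)] and at most [q' . (grad xi q' - grad xi q)],
    the rest being the convexity defect of [xi] at one of the two ends; in the
    upper bound [q' <= 1]. *)
Lemma covariance_bounds : forall q q' : S -> R, (forall s, 0 <= q s <= q' s) ->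
  (forall s, q' s <= 1) ->
  [/\ forall s, 0 <= xi_s s q,
      forall s, 0 <= xi_s s q' - xi_s s q <= C_star * \sum_s' (q' s' - q s') &
      0 <= theta q' - theta q <= \sum_s lambda s * (xi_s s q' - xi_s s q)].
Proof.
have [r [e [r1 sr xiE]]] := xi_psum.
pose r' := (1 + r) / 2; pose r'' := (1 + r') / 2.
have rr' : r' < r by rewrite /r'; lra.
have r'1 : 1 < r' by rewrite /r'; lra.
have r'0 : 0 <= r' by lra.
have r0 : 0 <= (1 : R) by [].
have pE s q : (forall s, `|q s| <= r') -> partial xi s q = psum (deriv_series s e) q.
  move=> qr'; rewrite -[RHS]mul1r; apply: (partial_psum s r'0 rr' sr) => //.
  by move=> q1 _; rewrite mul1r xiE.
have xisE s q : (forall s, `|q s| <= r') -> xi_s s q = (lambda s)^-1 * psum (deriv_series s e) q.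
  by move=> qr'; rewrite /xi_s pE.
have ss s : summable_at r' (deriv_series s e) by exact: summable_deriv_series rr' sr.
have ppE s s' : partial (xi_s s) s' (fun=> 1) =
    (lambda s)^-1 * psum (deriv_series s' (deriv_series s e)) (fun=> 1).
  apply: (partial_psum s' r0 r'1 (ss s)) => [q|_]; first exact: xisE.
  by rewrite normr1.
have Cge s s' : partial (xi_s s) s' (fun=> 1) <= C_star.
  apply: ub_le_sup; last by exists (s, s').
  exists (\sum_(ss : S * S) `|partial (xi_s ss.1) ss.2 (fun=> 1)|).
  move=> _ [[t t'] _ <-] /=.
  by rewrite (bigD1 (t, t'))//= (le_trans (ler_norm _))// lerDl sumr_ge0.
move=> q q' qq' q'1.
have q0 s : 0 <= q s by have /andP[] := qq' s.
have q'0 s : 0 <= q' s by have /andP[/le_trans] := qq' s; apply.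
have q1 s : q s <= 1 by have /andP[_ /le_trans] := qq' s; apply.
have dq s : 0 <= q' s - q s by rewrite subr_ge0; have /andP[] := qq' s.
have nq s : `|q s| <= r' by rewrite ger0_norm// (le_trans (q1 s))// ltW.
have nq' s : `|q' s| <= r' by rewrite ger0_norm// (le_trans (q'1 s))// ltW.
have li s : 0 <= (lambda s)^-1 by rewrite invr_ge0 ltW//; have /andP[] := lambda01 s.
have lK s x : lambda s * ((lambda s)^-1 * x) = x.
  by rewrite mulVKf// gt_eqF//; have /andP[] := lambda01 s.
have ge0 s : 0 <= psum (deriv_series s e) q.
  by apply: (psum_ge0 (ss s)) => s'; rewrite q0 (le_trans (q1 s'))// ltW.
have ge0' s : 0 <= psum (deriv_series s e) q'.
  by apply: (psum_ge0 (ss s)) => s'; rewrite q'0 (le_trans (q'1 s'))// ltW.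
have mono s : psum (deriv_series s e) q <= psum (deriv_series s e) q'.
  by apply: (psum_mono (ss s)) => // s'; rewrite (le_trans (q'1 s'))// ltW.
split=> [s|s|].
- by rewrite xisE// mulr_ge0.
- rewrite !xisE// -mulrBr mulr_ge0 ?subr_ge0//=.
  have /andP[_ up] := psum_convex r'1 (ss s) qq' q'1 ler01.
  apply: le_trans (ler_wpM2l (li s) up) _.
  rewrite !mulr_sumr; apply: ler_sum => s' _; rewrite mulrA ler_wpM2r//.
  apply: le_trans (Cge s s'); rewrite ppE ler_wpM2l//.
  have s2 : summable_at 1 (deriv_series s' (deriv_series s e))
    by exact: summable_deriv_series r'1 (ss s).
  by apply: (psum_mono s2) => // t; rewrite q'0 q'1.
- have thE x : (forall s, `|x s| <= r') ->
      theta x = \sum_s x s * psum (deriv_series s e) x - psum e x.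
    by move=> xr; rewrite /theta xiE; congr (_ - _); apply: eq_bigr => s _; rewrite pE.
  rewrite !thE//.
  have /andP[lo up] := psum_convex r1 sr qq' q'1 ler01.
  have -> : \sum_s lambda s * (xi_s s q' - xi_s s q) =
      \sum_s (psum (deriv_series s e) q' - psum (deriv_series s e) q).
    by apply: eq_bigr => s _; rewrite !xisE// -mulrBr lK.
  have E (p : S -> R) : \sum_s p s * (q' s - q s) = \sum_s q' s * p s - \sum_s q s * p s.
    by rewrite -sumrB; apply: eq_bigr => s _; ring.
  rewrite !E in lo up.
  have m1 : \sum_s q s * psum (deriv_series s e) q <= \sum_s q s * psum (deriv_series s e) q'.
    by apply: ler_sum => s _; rewrite ler_wpM2l.
  have m2 : \sum_s q' s * psum (deriv_series s e) q' - \sum_s q' s * psum (deriv_series s e) q <=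
      \sum_s (psum (deriv_series s e) q' - psum (deriv_series s e) q).
    rewrite -sumrB; apply: ler_sum => s _; rewrite -mulrBr ler_piMl ?subr_ge0//.
  lra.
Qed.

End covariance.

(** * Eliminating the path from the Parisi functional *)

Section one_species.
Context (R : realType).
Notation mu := (@lebesgue_measure R).
Variable zeta : probability (measurableTypeR R) R.
Hypothesis zeta01 : zeta `[0, 1]%classic = 1%E.
Variables (g : R -> R) (L : R).
Hypothesis glip : forall x y : R, 0 <= x -> x <= y -> y <= 1 -> 0 <= g y - g x <= L * (y - x).
Hypothesis g0 : 0 <= g 0.

Local Notation F := (cdf01 zeta).
Local Notation Q := (quantile01 zeta).
Local Notation X := (fun z => g (Q z)).
Local Notation x1 := (g 1).

Lemma g_nd (x y : R) : 0 <= x -> x <= y -> y <= 1 -> g x <= g y.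
Proof. by move=> x0 xy y1; have /andP[] := glip x0 xy y1; rewrite subr_ge0. Qed.

Lemma integral_cdf_derive (q : R) : 0 <= q <= 1 ->
  \int[mu]_(u in `[q, 1]) (F u * derive1 g u) =
  \int[mu]_(z in `[0, 1]) (g 1 - g (Num.max q (Q z))).
Proof.
move=> q01; have /andP[q0 q1] := q01.
have [f [f0 fi fE fae]] := lipschitz_FTC glip.
rewrite -(quantile_fubini zeta01 f0 fi fE q01).
apply: ae_eq_Rintegral_itv; move: fae; apply: filterS.
  exact: (ae_filter_ringOfSetsType mu).
move=> x fx /andP[qx xq]; have [|_ ->//] := fx.
by rewrite (le_lt_trans q0 qx).
Qed.

Lemma quantile_profile : profile x1 X.
Proof.
split=> [z /andP[z0 z1]|z z' z0 zz' z1].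
  have Q0 := quantile_ge0 zeta01 z1; have Q1 := quantile_le1 zeta01 z1.
  by rewrite (le_trans g0)// g_nd.
have z1' := le_trans zz' z1.
by apply: g_nd; [exact: quantile_ge0|exact: quantile_nd|exact: quantile_le1].
Qed.

Lemma g_maxE (q z : R) : 0 <= q <= 1 -> z <= 1 ->
  g (Num.max q (Q z)) = Num.max (g q) (g (Q z)).
Proof.
move=> /andP[q0 q1] z1.
have Q0 := quantile_ge0 zeta01 z1; have Q1 := quantile_le1 zeta01 z1.
case: (leP q (Q z)) => [qQ|/ltW Qq]; first by rewrite max_r// g_nd.
by rewrite max_l// g_nd.
Qed.

(** [g (max q (Q z))] is [max (g q) (X z)]: after the substitution the path only
    appears through [X]. *)
Lemma integral_cdf_derive_tail (q : R) : 0 <= q <= 1 ->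
  \int[mu]_(u in `[q, 1]) (F u * derive1 g u) = tail x1 X (g q).
Proof.
move=> q01; rewrite integral_cdf_derive// /tail.
transitivity (\int[mu]_(z in `[0, 1]) (x1 - Num.max (g q) (X z))).
  apply: eq_Rintegral => z; rewrite inE/= in_itv/= => /andP[_ z1].
  by rewrite g_maxE.
rewrite RintegralB//; last exact: (integrable_max quantile_profile).
  by rewrite Rintegral_itv_cst// subr0 mulr1.
exact: integrable_nondecreasing_itv.
Qed.

Lemma tail_le_g0 x : 0 <= x -> x <= g 0 -> tail x1 X x = tail x1 X (g 0).
Proof.
move=> x0 xg.
have gX z : 0 <= z <= 1 -> g 0 <= X z.
  by move=> /andP[z0 z1]; apply: g_nd; [|exact: quantile_ge0|exact: quantile_le1].
by apply: tail_flat => // z /gX; exact: le_trans.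
Qed.

Section change_of_variables.
Variable b : R.
Hypothesis bt : tail x1 X 0 < b.

Local Notation k := (fun x => (b - tail x1 X x)^-1).

Let pX := quantile_profile.

Let tail_le0 x : tail x1 X x <= tail x1 X 0.
Proof.
have [x0|/ltW x0] := leP 0 x; first exact: (tail_ni pX).
rewrite (@tail_flat _ _ _ x 0)// => z /pX.1 /andP[]// X0 _.
exact: le_trans X0.
Qed.

Let bt_gt0 x : 0 < b - tail x1 X x.
Proof. by rewrite subr_gt0 (le_lt_trans (tail_le0 x)). Qed.

Let k_ge0 x : 0 <= k x. Proof. by rewrite invr_ge0 ltW. Qed.

Let k_ni x y : x <= y -> k y <= k x.
Proof.
move=> xy; rewrite lef_pV2 ?posrE ?bt_gt0//.
by rewrite lerD2l lerN2 (tail_ni pX).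
Qed.

Let k_int a c : mu.-integrable `[a, c] (EFin \o k).
Proof. by apply: integrable_nonincreasing_itv => x y _ xy _; exact: k_ni. Qed.

Let k_cont : continuous k.
Proof.
move=> x; apply: cvgV; first by rewrite gt_eqF.
by apply: cvgB; [exact: cvg_cst|exact: (tail_continuous pX)].
Qed.

(* The lower bound -1 makes H differentiable at 0, a possible value of g inside
   the interval. *)
Let H x := \int[mu]_(t in `[-1, x]) k t.

Let H_sub x y : -1 <= x -> x <= y -> H y - H x = \int[mu]_(t in `[x, y]) k t.
Proof.
move=> x1 xy; rewrite /H Rintegral_itvB ?bnd_simp//.
rewrite Rintegral_itv_obnd_cbnd//; apply: integrableS (k_int x y) => //.
by apply: subset_itvr; rewrite bnd_simp.
Qed.

(** Change of variables [x = g q] for a [g] that is neither injective nor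
    differentiable everywhere: [H] is a primitive of the continuous function [k],
    so [H \o g] is again nondecreasing and Lipschitz, and its derivative is
    [k (g q) * derive1 g q] wherever [g] is differentiable. *)
Lemma integral_derive_inv_tail :
  \int[mu]_(q in `[0, 1]) (derive1 g q / (b - tail x1 X (g q))) =
  \int[mu]_(x in `[g 0, g 1]) k x.
Proof.
have ng (x : R) : 0 <= x -> x <= 1 -> 0 <= g x.
  by move=> x0 x1; rewrite (le_trans g0)// g_nd.
pose K := k 0.
have K0 : 0 <= K by exact: k_ge0.
have Hglip (x y : R) : 0 <= x -> x <= y -> y <= 1 ->
    0 <= H (g y) - H (g x) <= K * L * (y - x).
  move=> x0 xy y1; have /andP[gl gu] := glip x0 xy y1.
  have gxy : g x <= g y by exact: g_nd.
  have gx0 : 0 <= g x by apply: ng => //; exact: le_trans xy y1.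
  rewrite H_sub//; last by rewrite (le_trans _ gx0)// lerN10.
  rewrite Rintegral_itv_ge0//=.
  apply: (@le_trans _ _ (\int[mu]_(t in `[g x, g y]) K)).
    apply: le_Rintegral_itv => //; first exact: integrable_nondecreasing_itv.
    by move=> t /andP[gxt _]; apply: k_ni; exact: le_trans gxt.
  by rewrite Rintegral_itv_cst// -mulrA ler_wpM2l.
have [f [_ _ _ fae]] := lipschitz_FTC glip.
have [f2 [_ _ f2E f2ae]] := lipschitz_FTC (g := H \o g) Hglip.
rewrite -H_sub//; last 2 first.
- by rewrite (le_trans _ g0)// lerN10.
- exact: g_nd.
rewrite -[RHS](f2E 0 1)//.
apply: ae_eq_Rintegral_itv; move: fae f2ae; apply: filterS2.
  exact: (ae_filter_ringOfSetsType mu).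
move=> x fx f2x x01; have [dg _] := fx x01; have [_ <-] := f2x x01.
have /andP[/ltW x0 /ltW x1] := x01.
have [dH HE] : derivable H (g x) 1 /\ derive1 H (g x) = k (g x).
  apply: (@continuous_FTC1_closed _ k (-1) (g x) (g x + 1)).
  - by rewrite ltrDl.
  - exact: k_int.
  - by rewrite (lt_le_trans _ (ng x x0 x1))// ltrN10.
  - exact: k_cont.
by rewrite (derive1_comp dg dH) HE mulrC.
Qed.

(** [tail] is constant below [g 0], so the fraction [g 0 / (b - tail (g 0))] is the
    part over [[0, g 0]] of the integral defining [free_energy]. *)
Lemma free_energyE :
  b - 1 - ln b + g 0 / (b - tail x1 X (g 0)) +
    \int[mu]_(q in `[0, 1]) (derive1 g q / (b - tail x1 X (g q))) =
  free_energy x1 X b.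
Proof.
rewrite integral_derive_inv_tail /free_energy -addrA; congr (_ + _).
have g01 : g 0 <= g 1 by exact: g_nd.
have m1 : (-1 : R) <= 0 by rewrite lerN10.
rewrite -H_sub//; last exact: le_trans g0.
rewrite -[RHS]H_sub//; last exact: le_trans g01.
suff -> : g 0 / (b - tail x1 X (g 0)) = H (g 0) - H 0 by ring.
rewrite H_sub//.
transitivity (\int[mu]_(x in `[0, g 0]) k (g 0)).
  by rewrite Rintegral_itv_cst// subr0 mulrC.
apply: eq_Rintegral => x; rewrite inE/= in_itv/= => /andP[x0 xg].
by rewrite (tail_le_g0 x0 xg).
Qed.

End change_of_variables.
End one_species.

(** * Comparison of two pairs *)

Section real_inequalities.
Context (R : realType).

Lemma sub_le_dist_meet (a b c T1 T2 : R) : `|a - c| <= T1 -> `|b - c| <= T2 ->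
  a - b <= T1 + T2.
Proof. by rewrite !ler_norml => /andP[_ ?] /andP[? _]; lra. Qed.

Lemma dist_le1 (a b : R) : 0 <= a <= 1 -> 0 <= b <= 1 -> `|a - b| <= 1.
Proof. by rewrite ler_norml => /andP[? ?] /andP[? ?]; lra. Qed.

Lemma weighted_difference_le (l f2 f1 i1 i2 : R) : 0 <= l -> f2 <= f1 + (i1 - i2) ->
  l / 2 * f2 <= l / 2 * f1 + 2^-1 * (l * i1 - l * i2).
Proof.
move=> l0; have l2 : 0 <= l / 2 by rewrite divr_ge0.
move=> /(ler_wpM2l l2) /le_trans; apply.
by rewrite le_eqVlt; apply/orP; left; apply/eqP; field.
Qed.

Lemma functional_difference_le (C a2 a1 u2 u1 c2 c1 t p : R) :
  a2 <= a1 + 2^-1 * (u1 - u2) -> c2 - u2 - (c1 - u1) <= C * p ->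
  a2 - 2^-1 * (t - c2) <= a1 - 2^-1 * (t - c1) + C / 2 * p.
Proof. by lra. Qed.

End real_inequalities.

Section parisi.
Context (R : realType) (S : finType).
Notation mu := (@lebesgue_measure R).
Variables (lambda : S -> R) (beta : nat -> R) (Delta2 : forall p : nat, p.-tuple S -> R).
Arguments Delta2 : clear implicits.
Hypothesis lambda01 : forall s, 0 < lambda s <= 1.
Hypothesis lambda_sum : \sum_(s : S) lambda s = 1.
Hypothesis Delta2_ge0 : forall (p : nat) (t : p.-tuple S), (1 <= p)%N -> 0 <= Delta2 p t.
Hypothesis decay : decay_condition lambda beta Delta2.

Local Notation xi_s := (xi_s lambda beta Delta2).
Local Notation theta := (theta lambda beta Delta2).
Local Notation C_star := (C_star lambda beta Delta2).
Local Notation bounds := (covariance_bounds lambda01 Delta2_ge0 decay).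

Lemma lambda_mean (c : R) : \sum_s lambda s * c = c.
Proof. by rewrite -mulr_suml lambda_sum mul1r. Qed.

Lemma theta_lip (q q' : S -> R) : (forall s, 0 <= q s <= q' s) ->
  (forall s, q' s <= 1) ->
  0 <= theta q' - theta q <= C_star * \sum_s (q' s - q s).
Proof.
move=> qq' q'1; have [_ xiD /andP[t0 t1]] := bounds qq' q'1.
rewrite t0 (le_trans t1)// -[leRHS]lambda_mean; apply: ler_sum => s _.
have /andP[_ xs] := xiD s.
by rewrite ler_wpM2l// ltW//; have /andP[] := lambda01 s.
Qed.

Section pair.
Variables (zeta : probability (measurableTypeR R) R) (Phi : R -> S -> R).
Hypothesis adm : admissible_pair lambda zeta Phi.

Local Notation Q := (quantile01 zeta).
Local Notation g s := (fun q => xi_s s (Phi q)).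
Local Notation X s := (fun z => xi_s s (Phi (Q z))).
Local Notation x1 s := (xi_s s (fun=> 1)).

Let zeta01 : zeta `[0, 1]%classic = 1%E. Proof. exact: adm.1. Qed.

Lemma admissible_itv q s : 0 <= q <= 1 -> 0 <= Phi q s <= 1.
Proof.
by move=> q01; have [/(_ q s)] := adm.2; rewrite !in_itv/= => /(_ q01).
Qed.

Lemma admissible_nd q q' s : 0 <= q -> q <= q' -> q' <= 1 -> Phi q s <= Phi q' s.
Proof.
move=> q0 qq' q'1; have [_ _ nd _] := adm.2; apply: (nd s) => //.
  by rewrite in_itv/= q0 (le_trans qq').
by rewrite in_itv/= q'1 (le_trans q0).
Qed.

Lemma admissible_sum q : 0 <= q <= 1 -> \sum_s lambda s * Phi q s = q.
Proof. by move=> q01; have [_ _ _] := adm.2; apply; rewrite in_itv. Qed.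

Let lambda_ge0 s : 0 <= lambda s. Proof. by have /andP[/ltW] := lambda01 s. Qed.

Lemma admissible0 : Phi 0 = fun=> 0.
Proof.
apply/funext => s.
have h0 : 0 <= (0 : R) <= 1 by rewrite lexx ler01.
have /eqP := admissible_sum h0.
rewrite psumr_eq0 => [/allP/(_ s)|t _].
  rewrite mem_index_enum mulf_eq0 => /(_ isT) /orP[/eqP l0|/eqP//].
  by have := lambda01 s; rewrite l0 ltxx.
by rewrite mulr_ge0//; have /andP[] := admissible_itv t h0.
Qed.

Lemma admissible1 : Phi 1 = fun=> 1.
Proof.
apply/funext => s.
have h1 : 0 <= (1 : R) <= 1 by rewrite lexx ler01.
have : \sum_t lambda t * (1 - Phi 1 t) == 0.
  under eq_bigr do rewrite mulrBr mulr1.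
  by rewrite sumrB lambda_sum (admissible_sum h1) subrr.
rewrite psumr_eq0 => [/allP/(_ s)|t _].
  rewrite mem_index_enum mulf_eq0 => /(_ isT) /orP[/eqP l0|].
    by have := lambda01 s; rewrite l0 ltxx.
  by rewrite subr_eq0 => /eqP.
by rewrite mulr_ge0// subr_ge0; have /andP[] := admissible_itv t h1.
Qed.

Let K := \sum_s (lambda s)^-1.

Lemma admissible_lip q q' : 0 <= q -> q <= q' -> q' <= 1 ->
  \sum_s (Phi q' s - Phi q s) <= K * (q' - q).
Proof.
move=> q0 qq' q'1; rewrite mulr_suml; apply: ler_sum => s _.
have l0 : 0 < lambda s by have /andP[] := lambda01 s.
rewrite ler_pdivlMl//.
have -> : q' - q = \sum_t lambda t * (Phi q' t - Phi q t).
  under eq_bigr do rewrite mulrBr.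
  by rewrite sumrB !admissible_sum ?q0 ?q'1 ?(le_trans q0) ?(le_trans qq').
rewrite (bigD1 s)//= lerDl sumr_ge0// => t _.
by rewrite mulr_ge0// subr_ge0 admissible_nd.
Qed.

Let Phi_ord q q' : 0 <= q -> q <= q' -> q' <= 1 -> forall s, 0 <= Phi q s <= Phi q' s.
Proof.
move=> q0 qq' q'1 s; rewrite admissible_nd// andbT.
have q01 : 0 <= q <= 1 by rewrite q0 (le_trans qq').
by have /andP[] := admissible_itv s q01.
Qed.

Let Phi_le1 q : 0 <= q <= 1 -> forall s, Phi q s <= 1.
Proof. by move=> q01 s; have /andP[] := admissible_itv s q01. Qed.

Let L := `|C_star| * K.

Let lipL q q' : 0 <= q -> q <= q' -> q' <= 1 ->
  C_star * \sum_s (Phi q' s - Phi q s) <= L * (q' - q).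
Proof.
move=> q0 qq' q'1; rewrite -mulrA.
apply: (@le_trans _ _ (`|C_star| * \sum_s (Phi q' s - Phi q s))).
  rewrite ler_wpM2r ?ler_norm// sumr_ge0// => s _.
  by rewrite subr_ge0 admissible_nd.
by rewrite ler_wpM2l// admissible_lip.
Qed.

Lemma xi_s_Phi_lip s (q q' : R) : 0 <= q -> q <= q' -> q' <= 1 ->
  0 <= g s q' - g s q <= L * (q' - q).
Proof.
move=> q0 qq' q'1.
have q'P : forall s, Phi q' s <= 1 by apply: Phi_le1; rewrite q'1 (le_trans q0).
have [_ /(_ s) /andP[l u] _] := bounds (Phi_ord q0 qq' q'1) q'P.
by rewrite l (le_trans u)// lipL.
Qed.

Lemma theta_Phi_lip (q q' : R) : 0 <= q -> q <= q' -> q' <= 1 ->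
  0 <= theta (Phi q') - theta (Phi q) <= L * (q' - q).
Proof.
move=> q0 qq' q'1.
have q'P : forall s, Phi q' s <= 1 by apply: Phi_le1; rewrite q'1 (le_trans q0).
have /andP[-> u] := theta_lip (Phi_ord q0 qq' q'1) q'P.
by rewrite (le_trans u)// lipL.
Qed.

Lemma xi_s_Phi0_ge0 s : 0 <= g s 0.
Proof.
have P1 : forall s, Phi 1 s <= 1 by apply: Phi_le1; rewrite ler01 lexx.
by have [/(_ s)] := bounds (Phi_ord (lexx 0) ler01 (lexx 1)) P1.
Qed.

Lemma xi_s_profile s : profile (x1 s) (X s).
Proof.
rewrite -admissible1.
exact: (quantile_profile zeta01 (@xi_s_Phi_lip s) (xi_s_Phi0_ge0 s)).
Qed.

Lemma d_s_tail s q : 0 <= q <= 1 ->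
  d_s lambda beta Delta2 zeta Phi s q = tail (x1 s) (X s) (g s q).
Proof.
move=> q01; rewrite -admissible1.
exact: (integral_cdf_derive_tail zeta01 (@xi_s_Phi_lip s) (xi_s_Phi0_ge0 s)).
Qed.

Lemma d_s0_tail s : d_s lambda beta Delta2 zeta Phi s 0 = tail (x1 s) (X s) 0.
Proof.
rewrite d_s_tail ?lexx ?ler01// -admissible1.
by rewrite (tail_le_g0 zeta01 (@xi_s_Phi_lip s) (lexx _) (xi_s_Phi0_ge0 s)).
Qed.

Lemma integrable_theta_Phi :
  mu.-integrable `[0, 1] (EFin \o (fun z => theta (Phi (Q z)))).
Proof.
apply: integrable_nondecreasing_itv => z z' z0 zz' z'1.
have z1 := le_trans zz' z'1.
rewrite -subr_ge0.
by have /andP[] := theta_Phi_lip (quantile_ge0 zeta01 z1)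
  (quantile_nd zeta01 zz' z'1) (quantile_le1 zeta01 z'1).
Qed.

Lemma quantile_itv z : 0 <= z <= 1 -> 0 <= Q z <= 1.
Proof. by move=> /andP[_ z1]; rewrite quantile_ge0 ?quantile_le1. Qed.

Lemma measurable_Phi_quantile s : measurable_fun (`[0, 1]%classic : set R) (fun z => Phi (Q z) s).
Proof.
apply: measurable_nondecreasing_itv => z z' z0 zz' z'1.
have z1 := le_trans zz' z'1.
by apply: admissible_nd; [exact: quantile_ge0|exact: quantile_nd|exact: quantile_le1].
Qed.

Lemma Parisi_A_free_energy (b : S -> R) :
  (forall s, tail (x1 s) (X s) 0 < b s) ->
  Parisi_A lambda beta Delta2 zeta Phi b =
  \sum_s lambda s / 2 * free_energy (x1 s) (X s) (b s)
  - 2^-1 * (theta (fun=> 1) - \int[mu]_(z in `[0, 1]) theta (Phi (Q z))).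
Proof.
move=> bt; rewrite /Parisi_A; congr (_ - _ * _).
  apply: eq_bigr => s _; congr (_ * _).
  have fE := free_energyE zeta01 (@xi_s_Phi_lip s) (xi_s_Phi0_ge0 s).
  have tE := tail_le_g0 zeta01 (@xi_s_Phi_lip s) (lexx _) (xi_s_Phi0_ge0 s).
  rewrite /= admissible0 admissible1 in fE tE.
  rewrite -fE// d_s0_tail tE; congr (_ + _).
  apply: eq_Rintegral => q; rewrite inE/= in_itv/= => q01.
  by rewrite d_s_tail.
rewrite /theta_Phi' (integral_cdf_derive zeta01 theta_Phi_lip) ?lexx ?ler01//.
transitivity (\int[mu]_(z in `[0, 1]) (theta (fun=> 1) - theta (Phi (Q z)))).
  apply: eq_Rintegral => z; rewrite inE/= in_itv/= => /andP[_ z1].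
  by rewrite admissible1 max_r// quantile_ge0.
rewrite RintegralB//.
- by rewrite Rintegral_itv_cst// subr0 mulr1.
- exact: integrable_nondecreasing_itv.
exact: integrable_theta_Phi.
Qed.

End pair.

Section lipschitz_integrand.
Variable G : S -> R -> R.
Hypothesis Glip : forall s y y', y <= y' -> 0 <= G s y' - G s y <= y' - y.

Let h q := theta q - \sum_s lambda s * G s (xi_s s q).

(* Two increments in the same interval [0, T] differ by at most T. *)
Let h_lip_ordered (q q' : S -> R) : (forall s, 0 <= q s <= q' s) ->
  (forall s, q' s <= 1) -> `|h q' - h q| <= C_star * \sum_s (q' s - q s).
Proof.
move=> qq' q'1; have /andP[t0 t1] := theta_lip qq' q'1.
have [_ xiD _] := bounds qq' q'1.
have -> : h q' - h q = (theta q' - theta q) -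
    \sum_s lambda s * (G s (xi_s s q') - G s (xi_s s q)).
  by under [in RHS]eq_bigr do rewrite mulrBr; rewrite sumrB /h; ring.
have l0 s : 0 <= lambda s by have /andP[/ltW] := lambda01 s.
have xs s : xi_s s q <= xi_s s q' by have /andP[] := xiD s; rewrite subr_ge0.
have G0 : 0 <= \sum_s lambda s * (G s (xi_s s q') - G s (xi_s s q)).
  by apply: sumr_ge0 => s _; rewrite mulr_ge0//; have /andP[] := Glip s (xs s).
have G1 : \sum_s lambda s * (G s (xi_s s q') - G s (xi_s s q)) <= C_star * \sum_s (q' s - q s).
  rewrite -[leRHS]lambda_mean; apply: ler_sum => s _; rewrite ler_wpM2l//.
  by have /andP[_ /le_trans] := Glip s (xs s); apply; have /andP[] := xiD s.
rewrite ler_norml; lra.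
Qed.

(** Ordered points are handled by [h_lip_ordered]; the l1 distance of two points is
    the sum of their distances to the coordinatewise minimum. *)
Lemma theta_transport_lip (q q' : S -> R) : (forall s, 0 <= q s <= 1) ->
  (forall s, 0 <= q' s <= 1) ->
  (theta q - \sum_s lambda s * G s (xi_s s q)) -
  (theta q' - \sum_s lambda s * G s (xi_s s q')) <= C_star * \sum_s `|q s - q' s|.
Proof.
move=> q01 q'01; rewrite -/(h q) -/(h q').
pose m s := Num.min (q s) (q' s).
have mq s : 0 <= m s <= q s.
  by have /andP[a _] := q01 s; have /andP[b _] := q'01 s; rewrite le_min a b ge_min lexx.
have mq' s : 0 <= m s <= q' s.
  by have /andP[a _] := q01 s; have /andP[b _] := q'01 s; rewrite le_min a b ge_min lexx orbT.
have q1 s : q s <= 1 by have /andP[] := q01 s.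
have q'1 s : q' s <= 1 by have /andP[] := q'01 s.
have -> : \sum_s `|q s - q' s| = \sum_s (q s - m s) + \sum_s (q' s - m s).
  rewrite -big_split/=; apply: eq_bigr => s _; rewrite /m.
  case: (leP (q s) (q' s)) => [qq|/ltW qq].
    by rewrite distrC ger0_norm ?subr_ge0//; ring.
  by rewrite ger0_norm ?subr_ge0//; ring.
rewrite (mulrDr C_star).
exact: sub_le_dist_meet (h_lip_ordered mq q1) (h_lip_ordered mq' q'1).
Qed.

End lipschitz_integrand.

Section two_pairs.
Variables (zeta1 : probability (measurableTypeR R) R) (Phi1 : R -> S -> R).
Variables (zeta2 : probability (measurableTypeR R) R) (Phi2 : R -> S -> R).
Hypotheses (adm1 : admissible_pair lambda zeta1 Phi1)
  (adm2 : admissible_pair lambda zeta2 Phi2).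

Local Notation Y1 := (fun z => Phi1 (quantile01 zeta1 z)).
Local Notation Y2 := (fun z => Phi2 (quantile01 zeta2 z)).
Local Notation A1 := (Parisi_A lambda beta Delta2 zeta1 Phi1).
Local Notation A2 := (Parisi_A lambda beta Delta2 zeta2 Phi2).
Local Notation ok zeta Phi := (fun b : S -> R =>
  forall s, 0 < b s /\ d_s lambda beta Delta2 zeta Phi s 0 < b s).

(** The point [b2] is stationary for the second pair; the same [b2] serves for
    every [b1], which is why infima can be compared. *)
Lemma Parisi_A_comparison : exists2 b2, ok zeta2 Phi2 b2 &
  forall b1, ok zeta1 Phi1 b1 ->
    A2 b2 <= A1 b1 + C_star / 2 * pair_dist zeta1 Phi1 zeta2 Phi2.
Proof.
have x1_ge0 s : 0 <= xi_s s (fun=> 1).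
  have a1 (t : S) : 0 <= (1 : R) <= 1 by rewrite lexx ler01.
  have b1 (t : S) : (1 : R) <= 1 by [].
  by have [/(_ s)] := bounds a1 b1.
have env s := free_energy_envelope (x1_ge0 s) (xi_s_profile adm2 s).
have [b2 hb2] := choice env.
have [G hG] := choice hb2.
exists b2 => [s|b1 ok1].
  by rewrite (d_s0_tail adm2); have [] := hG s.
have Glip s : forall y y', y <= y' -> 0 <= G s y' - G s y <= y' - y by have [] := hG s.
have pX1 := xi_s_profile adm1; have pX2 := xi_s_profile adm2.
have iG (zeta : probability (measurableTypeR R) R) (Phi : R -> S -> R) s :
    profile (xi_s s (fun=> 1)) (fun z => xi_s s (Phi (quantile01 zeta z))) ->
    mu.-integrable `[0, 1] (EFin \o (fun z => G s (xi_s s (Phi (quantile01 zeta z))))).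
  move=> pX; apply: integrable_nondecreasing_itv => z z' z0 zz' z1.
  by rewrite -subr_ge0; have /andP[] := Glip s _ _ (pX.2 _ _ z0 zz' z1).
have [iS1 ES1] := Rintegral_itv_sum (index_enum S)
  (fun s => integrable_itvZ (lambda s) (iG zeta1 Phi1 s (pX1 s))).
have [iS2 ES2] := Rintegral_itv_sum (index_enum S)
  (fun s => integrable_itvZ (lambda s) (iG zeta2 Phi2 s (pX2 s))).
have iT1 := integrable_theta_Phi adm1; have iT2 := integrable_theta_Phi adm2.
have iN s : mu.-integrable `[0, 1] (EFin \o (fun z => `|Y1 z s - Y2 z s|)).
  apply: (@integrable_itv_bounded _ _ _ 1) => [|z z01].
    apply: measurableT_comp => //; apply: measurable_funB; exact: measurable_Phi_quantile.
  rewrite normr_id; apply: dist_le1.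
    exact: (admissible_itv adm1 s (quantile_itv adm1 z01)).
  exact: (admissible_itv adm2 s (quantile_itv adm2 z01)).
have [iD _] := Rintegral_itv_sum (index_enum S) iN.
have ptw z : 0 <= z <= 1 ->
    (theta (Y2 z) - \sum_s lambda s * G s (xi_s s (Y2 z))) -
    (theta (Y1 z) - \sum_s lambda s * G s (xi_s s (Y1 z))) <=
    C_star * \sum_s `|Y1 z s - Y2 z s|.
  move=> z01.
  have q1 s := admissible_itv adm1 s (quantile_itv adm1 z01).
  have q2 s := admissible_itv adm2 s (quantile_itv adm2 z01).
  apply: le_trans (theta_transport_lip Glip q2 q1) _.
  by under eq_bigr do rewrite distrC.
have key := Rintegral_itv_diff_le iT2 iS2 iT1 iS1 iD ES2 ES1 ptw.
rewrite (Parisi_A_free_energy adm1); last first.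
  by move=> s; rewrite -(d_s0_tail adm1); have [] := ok1 s.
rewrite (Parisi_A_free_energy adm2); last by move=> s; have [] := hG s.
have FE : \sum_s lambda s / 2 * free_energy (xi_s s (fun=> 1)) (fun z => xi_s s (Y2 z)) (b2 s) <=
    \sum_s lambda s / 2 * free_energy (xi_s s (fun=> 1)) (fun z => xi_s s (Y1 z)) (b1 s) +
    2^-1 * (\sum_s \int[mu]_(z in `[0, 1]) (lambda s * G s (xi_s s (Y1 z))) -
      \sum_s \int[mu]_(z in `[0, 1]) (lambda s * G s (xi_s s (Y2 z)))).
  rewrite -sumrB mulr_sumr -big_split/=; apply: ler_sum => s _.
  have [_ _ _ /(_ _ _ (pX1 s) (ok1 s).1)] := hG s.
  rewrite -(d_s0_tail adm1) => /(_ (ok1 s).2).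
  have i1 := iG zeta1 Phi1 s (pX1 s); have i2 := iG zeta2 Phi2 s (pX2 s).
  rewrite (RintegralB _ i1 i2)// (RintegralZl _ _ i1)// (RintegralZl _ _ i2)//.
  by apply: weighted_difference_le; have /andP[/ltW] := lambda01 s.
exact: (functional_difference_le _ FE key).
Qed.

End two_pairs.

(** The comparison of the second pair with itself bounds its functional from below,
    so that its [inf] is a genuine infimum. *)
Lemma Parisi_le (zeta1 : probability (measurableTypeR R) R) (Phi1 : R -> S -> R)
    (zeta2 : probability (measurableTypeR R) R) (Phi2 : R -> S -> R) :
  admissible_pair lambda zeta1 Phi1 -> admissible_pair lambda zeta2 Phi2 ->
  Parisi lambda beta Delta2 zeta2 Phi2 <=
  Parisi lambda beta Delta2 zeta1 Phi1 + C_star / 2 * pair_dist zeta1 Phi1 zeta2 Phi2.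
Proof.
move=> adm1 adm2; have [b2 ok2 cmp] := Parisi_A_comparison adm1 adm2.
rewrite -lerBlDr; apply: lb_le_inf.
  pose b s := `|d_s lambda beta Delta2 zeta1 Phi1 s 0| + 1.
  exists (Parisi_A lambda beta Delta2 zeta1 Phi1 b), b => // s.
  by rewrite /b ltr_wpDl// (le_lt_trans (ler_norm _))// ltrDl.
move=> _ [b1 ok1 <-]; rewrite lerBlDr; apply: le_trans (cmp _ ok1).
apply: ge_inf; last by exists b2.
have [b3 ok3 cmp3] := Parisi_A_comparison adm2 adm2.
exists (Parisi_A lambda beta Delta2 zeta2 Phi2 b3 -
  C_star / 2 * pair_dist zeta2 Phi2 zeta2 Phi2).
by move=> _ [b ok <-]; rewrite lerBlDr; exact: cmp3.
Qed.

End parisi.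

Unset Implicit Arguments.
Unset Strict Implicit.

Theorem theorem1p5 (R : realType) (S : finType) (lambda : S -> R)
    (beta : nat -> R) (Delta2 : forall p : nat, p.-tuple S -> R)
    (lambda01 : forall s, 0 < lambda s <= 1)
    (lambda_sum : \sum_(s : S) lambda s = 1)
    (Delta2_ge0 : forall (p : nat) (t : p.-tuple S),
       (1 <= p)%N -> 0 <= Delta2 p t)
    (Delta2_sym : forall p : nat, (1 <= p)%N -> symmetric_array (Delta2 p))
    (decay : decay_condition lambda beta Delta2)
    (zeta1 : probability (measurableTypeR R) R) (Phi1 : R -> S -> R)
    (zeta2 : probability (measurableTypeR R) R) (Phi2 : R -> S -> R)
    (adm1 : admissible_pair lambda zeta1 Phi1)
    (adm2 : admissible_pair lambda zeta2 Phi2) :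
  `|Parisi lambda beta Delta2 zeta1 Phi1 - Parisi lambda beta Delta2 zeta2 Phi2|
    <= C_star lambda beta Delta2 / 2 * pair_dist zeta1 Phi1 zeta2 Phi2.
Proof.
have le12 := Parisi_le lambda01 lambda_sum Delta2_ge0 decay adm1 adm2.
have le21 := Parisi_le lambda01 lambda_sum Delta2_ge0 decay adm2 adm1.
have symD : pair_dist zeta2 Phi2 zeta1 Phi1 = pair_dist zeta1 Phi1 zeta2 Phi2.
  by apply: eq_Rintegral => z _; apply: eq_bigr => s _; rewrite distrC.
rewrite symD in le21.
have distP (x y e : R) : y <= x + e -> x <= y + e -> `|x - y| <= e.
  by rewrite ler_distl lerBlDr => -> ->.
exact: distP le12 le21.
Qed.
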